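(* Let $\Lambda\subset\mathbb{C}$ be a regular self-similar arc generated by a basic figure with vertices $z_0=0,z_1,\dots,z_\ell=1$. Suppose that $t\ge1$, $1\le p\le\ell-1$ and $\theta_p=0$. Then $\Lambda$ satisfies Condition $Q_p^t$ if and only if there exists a constant $C>0$ such that $$(\lambda^j+\mu^k)^t\le C|\alpha\lambda^j-\beta\mu^k|,\quad j,k=0,1,2,\dots.$$ Here, with $r_i$ the ratio of $S_i$, $\lambda=r_\ell$, $\mu=r_1$, $\alpha=r_p|1-z_q|$, $\beta=r_{p+1}|z_q|$.
   Context: Identify $\mathbb{R}^2$ with $\mathbb{C}$. Basic figures. Let $\Omega$ be a polygon formed by a sequence of successive segments in the plane, with $\ell+1$ vertices $z_0,z_1,\dots,z_\ell$, such that $z_1,z_{\ell-1}$ lie on the segment $\overline{z_0z_\ell}$ and $z_{\ell-1}$ lies on the segment $\overline{z_1z_\ell}$. Suppose there is a vertex $z_q$ such that all vertices belong to $\Pi=\{z_q\}\cup\overline{z_0z_\ell}\cup\Pi_0$, where $\Pi_0$ is the interior of the triangle $z_0z_\ell z_q$; let $\Pi_1$ be the closure of $\Pi_0$. For $j=1,\dots,\ell$ let $S_j$ be the unique orientation-preserving similitude (of the form $z\mapsto az+b$) with $S_j(z_0)=z_{j-1}$, $S_j(z_\ell)=z_j$; its ratio is $r_j=|a|$. $\Omega$ is a basic figure if moreover: the $S_j$ are contractive; the sets $S_j(\Pi_0)$ are pairwise disjoint; $S_j(z_q)\in\Pi_1$ for all $j$; and $S_j(\Pi_1)\cap(\overline{z_qz_0}\cup\overline{z_qz_\ell})=\emptyset$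 for $j\notin\{1,\ell,q,q+1\}$. Standing assumptions: $z_0=0$, $z_\ell=1$, $\operatorname{Im}z_q>0$. Angles (all arguments in $[0,2\pi)$). Corner angle at $z_p$, $1\le p\le\ell-1$: $\theta_p=\arg\frac{S_p(z_q)-z_p}{S_{p+1}(z_q)-z_p}$. Put $\theta_{\min}=\min_p\theta_p$, $\eta_1=\arg\frac{S_q(z_q)-z_q}{z_0-z_q}$, $\eta_2=\arg\frac{z_\ell-z_q}{S_{q+1}(z_q)-z_q}$, $\eta_0=\min(\eta_1,\eta_2)$. The characteristic angle is $\xi=\theta_{\min}+\eta_0$. Regular self-similar arcs. Let $\Lambda$ be the unique nonempty compact set with $\Lambda=\bigcup_{j=1}^\ell S_j(\Lambda)$. If $\Lambda$ is an arc (homeomorphic to $[0,1]$), it is called the self-similar arc generated by $\Omega$; it is ordered ($\prec$, $\preceq$) from $z_0$ to $z_\ell$, and $S_j(\Lambda)$ is its subarc from $z_{j-1}$ to $z_j$. A regular self-similar arc is a self-similar arc generated by a basic figure with positive characteristic angle. $|\Lambda(x,y)|$ is the diameter of the subarc of $\Lambda$ between $x$ and $y$. $\Lambda$ satisfies Condition $Q_p^t$ if there is a constant $C_p>0$ such that $|\Lambda(x,y)|^t\le C_p|x-y|$ whenever $x,y\in\Lambda$ and $z_{p-1}\preceq x\preceq z_p\preceq y\preceq z_{p+1}$. *)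

(* Defs.v *)
From HB Require Import structures.
From mathcomp Require Import all_boot all_order all_algebra.
From mathcomp Require Import complex.
From mathcomp Require Import all_classical all_reals all_analysis.

Set Implicit Arguments.
Unset Strict Implicit.
Unset Printing Implicit Defensive.

Import Order.TTheory GRing.Theory Num.Theory.
Import numFieldNormedType.Exports.

Local Open Scope classical_set_scope.
Local Open Scope ring_scope.
Local Open Scope complex_scope.

(* The usual topology of the plane, available so far only on [R[i]^o]. *)
HB.instance Definition _ (R : rcfType) := NormedModule.copy R[i] R[i]^o.

(* [`|w|] lives in [R[i]]; this is the real-valued modulus. *)
Notation normc := Normc.normc.

Section Plane.
Variable R : realType.
Implicit Types (w a b c : R[i]) (A : set R[i]).

(* Argument in [0, 2 pi); the value at 0 is irrelevant. *)
Definition argc w : R :=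
  let phi := acos (complex.Re w / normc w) in
  if 0 <= complex.Im w then phi else 2 * pi - phi.

Definition segment a b : set R[i] :=
  [set w | exists s : R, 0 <= s <= 1 /\ w = (1 - s)%:C * a + s%:C * b].

Definition triangle a b c : set R[i] :=
  [set w | exists s t u : R,
     [/\ 0 <= s, 0 <= t, 0 <= u, s + t + u = 1
       & w = s%:C * a + t%:C * b + u%:C * c]].

Definition diam A : R := sup [set normc (u - v) | u in A & v in A].

Definition arc_homeomorphism (f : R -> R[i]) A : Prop :=
  [/\ set_bij `[0, 1] A f, {within `[0, 1], continuous f}
    & exists2 g : R[i] -> R, {within A, continuous g}
                           & forall s, 0 <= s <= 1 -> g (f s) = s].

Definition is_arc A : Prop := exists f : R -> R[i], arc_homeomorphism f A.

(* The order of the arc [A] from its endpoint [a] to its endpoint [b]. *)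
Definition arc_le A a b (x y : R[i]) : Prop :=
  exists f : R -> R[i],
    [/\ arc_homeomorphism f A, f 0 = a, f 1 = b
      & exists s t : R, [/\ 0 <= s, s <= t, t <= 1, f s = x & f t = y]].

Definition subarc A a b (x y : R[i]) : set R[i] :=
  [set w | (arc_le A a b x w /\ arc_le A a b w y) \/
           (arc_le A a b y w /\ arc_le A a b w x)].

End Plane.

(* A figure is given by the number [ell] of its sides, the index [q] of its
   apex, and its vertices [z 0, ..., z ell]; the values [z j] for [j > ell] are
   never used. *)
Section Figure.
Variables (R : realType) (ell q : nat) (z : nat -> R[i]).

Definition simil_coef (j : nat) : R[i] := (z j - z j.-1) / (z ell - z 0%N).

(* [simil j] is S_j, for 1 <= j <= ell; see [simil_unique]. *)
Definition simil (j : nat) (w : R[i]) : R[i] :=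
  simil_coef j * w + (z j.-1 - simil_coef j * z 0%N).

Definition simil_ratio (j : nat) : R := normc (simil_coef j).

Definition Pi0 : set R[i] := (triangle (z 0%N) (z ell) (z q))°.

Definition Pi1 : set R[i] := closure Pi0.

Definition Pi : set R[i] :=
  [set z q] `|` segment (z 0%N) (z ell) `|` Pi0.

Record basic_figure : Prop := BasicFigure {
  bf_ends : z 0%N != z ell;
  bf_sides : forall j, (1 <= j <= ell)%N -> z j.-1 != z j;
  bf_first : segment (z 0%N) (z ell) (z 1%N);
  bf_last : segment (z 0%N) (z ell) (z ell.-1);
  bf_first_last : segment (z 1%N) (z ell) (z ell.-1);
  bf_apex : (q <= ell)%N;
  bf_vertices : forall j, (j <= ell)%N -> Pi (z j);
  bf_contractive : forall j, (1 <= j <= ell)%N -> simil_ratio j < 1;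
  bf_disjoint : forall i j, (1 <= i <= ell)%N -> (1 <= j <= ell)%N -> i != j ->
    simil i @` Pi0 `&` simil j @` Pi0 = set0;
  bf_inside : forall j, (1 <= j <= ell)%N -> Pi1 (simil j (z q));
  bf_off_sides : forall j, (1 <= j <= ell)%N -> j \notin [:: 1%N; ell; q; q.+1] ->
    simil j @` Pi1 `&` (segment (z q) (z 0%N) `|` segment (z q) (z ell)) = set0
}.

(* [theta p] is the corner angle at [z p], for 1 <= p <= ell - 1. *)
Definition theta (p : nat) : R :=
  argc ((simil p (z q) - z p) / (simil p.+1 (z q) - z p)).

Definition theta_min : R := \big[Num.min/theta 1%N]_(1 <= p < ell) theta p.

Definition eta1 : R := argc ((simil q (z q) - z q) / (z 0%N - z q)).

Definition eta2 : R := argc ((z ell - z q) / (simil q.+1 (z q) - z q)).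

Definition eta0 : R := Num.min eta1 eta2.

Definition xi : R := theta_min + eta0.

Definition attractor (Lam : set R[i]) : Prop :=
  [/\ Lam !=set0, compact Lam
    & Lam = \bigcup_(j in [set j | (1 <= j <= ell)%N]) simil j @` Lam].

Definition regular_self_similar_arc (Lam : set R[i]) : Prop :=
  [/\ basic_figure, 0 < xi, attractor Lam & is_arc Lam].

Definition condition_Q (Lam : set R[i]) (t : R) (p : nat) : Prop :=
  let le := arc_le Lam (z 0%N) (z ell) in
  exists2 C : R, 0 < C &
    forall x y, Lam x -> Lam y ->
      le (z p.-1) x -> le x (z p) -> le (z p) y -> le y (z p.+1) ->
      diam (subarc Lam (z 0%N) (z ell) x y) `^ t <= C * normc (x - y).

End Figure.

Lemma simil_unique (R : realType) (ell : nat) (z : nat -> R[i]) (j : nat)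
    (a b : R[i]) : z 0%N != z ell ->
  (a * z 0%N + b = z j.-1 /\ a * z ell + b = z j) <->
  (forall w, a * w + b = simil ell z j w).
Proof.
move=> z01; have d0 : z ell - z 0%N != 0 by rewrite subr_eq0 eq_sym.
rewrite /simil; split=> [[e0 e1] w|e].
  have <- : a = simil_coef ell z j.
    by rewrite /simil_coef -e0 -e1 opprD addrACA subrr addr0 -mulrBr mulfK.
  by rewrite -e0 [a * z 0%N + b]addrC addrK.
split; rewrite e; first by rewrite addrC subrK.
by rewrite addrCA -mulrBr /simil_coef divfK // addrC subrK.
Qed.

Lemma argcP (R : realType) (w : R[i]) : w != 0 ->
  0 <= argc w < 2 * pi /\
  w = (normc w * cos (argc w)) +i* (normc w * sin (argc w)).
Proof.
case: w => x y w0.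
have n0 : 0 < normc (x +i* y).
  rewrite lt_neqAle sqrtr_ge0 andbT eq_sym.
  by apply: contraNneq w0 => /Normc.eq0_normc ->.
have nE : normc (x +i* y) ^+ 2 = x ^+ 2 + y ^+ 2.
  by rewrite /= sqr_sqrtr // addr_ge0 ?sqr_ge0.
rewrite /argc; move: (normc _) n0 nE => n n0 nE /=.
have xn2 : (x / n) ^+ 2 = 1 - (y / n) ^+ 2.
  apply/eqP; rewrite eq_sym subr_eq !expr_div_n -mulrDl -nE.
  by rewrite divff // expf_neq0 // gt_eqF.
have xn : -1 <= x / n <= 1.
  by rewrite -ler_norml -(expr_le1 (n:=2)) // real_normK ?num_real // xn2
             gerBl sqr_ge0.
have ph0 := acos_ge0 xn; have php := acos_lepi xn.
have cE := acosK xn; have sE := sin_acos xn.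
have {}sE : sin (acos (x / n)) = `|y| / n.
  by rewrite sE xn2 opprB addrC subrK sqrtr_sqr normf_div (gtr0_norm n0).
have nx v : n * (v / n) = v by rewrite mulrC divfK // gt_eqF.
have p0 : 0 < (pi : R) by exact: pi_gt0.
case: ifPn => [y0|]; last rewrite -ltNge => y0.
  split; last by rewrite cE sE (ger0_norm y0) !nx.
  by rewrite ph0 /= (le_lt_trans php) // mulr_natl mulr2n ltrDl.
have pp : 0 < acos (x / n).
  rewrite lt_neqAle ph0 andbT eq_sym; apply: contraTneq y0 => e0.
  move: sE; rewrite e0 sin0 => /esym/eqP.
  by rewrite mulf_eq0 invr_eq0 (gt_eqF n0) orbF normr_eq0 => /eqP ->; rewrite ltxx.
split.
  rewrite subr_ge0 gtrBl pp andbT (le_trans php) //.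
  by rewrite mulr_natl mulr2n lerDl ltW.
have -> : 2 * pi - acos (x / n) = - acos (x / n) + pi *+ 2.
  by rewrite addrC mulr_natl.
rewrite cosD (sinD (- _)) cos2pi sin2pi !mulr0 !mulr1 subr0 addr0 cosN sinN cE sE.
by rewrite (ltr0_norm y0) mulNr opprK !nx.
Qed.

(* Main.v *)
Require Import Defs.
From mathcomp Require Import all_boot all_order all_algebra.
From mathcomp Require Import complex.
From mathcomp Require Import all_classical all_reals all_analysis.
From mathcomp Require Import ring lra zify.
Import Order.TTheory GRing.Theory Num.Theory.
Import numFieldNormedType.Exports.
Local Open Scope classical_set_scope.
Local Open Scope ring_scope.
Local Open Scope complex_scope.

Set Implicit Arguments.
Unset Strict Implicit.

(* Since [theta p = 0], the triangles [S p T] and [S p.+1 T] touch along a ray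
   from [z p], lie on opposite sides of it, and [eta1] and [eta2] are positive.
   Positivity of the latter makes the pieces [S i Lam], [i < ell], meet the side
   from [z q] to [1] at most at [z q], from which they leave at a positive
   angle; likewise for [1 < i] and the side from [z q] to [0].  Near [z p], the
   arc is made of the copies of these pieces scaled by [lambda ^+ j] on one side
   and [mu ^+ k] on the other, whose apices lie on the ray at distances
   [alpha * lambda ^+ j] and [beta * mu ^+ k] from [z p].  The apices themselves
   give one implication; conversely, by the angle condition, two points of these
   copies are at a distance at least a constant times that of the apices, while
   the subarc joining them has diameter comparable to [lambda ^+ j + mu ^+ k]
   at most. *)

(** Condition Q speaks of the order of the arc, whereas [Lam] is only an attractor homeomorphic to
    [0,1] by an unspecified map. A large part of the proof therefore shows that [0] and [1] are its
    ends and that [S j Lam] is the subarc from [z j.-1] to [z j]. Disjointness of the open triangles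
    enters here: two pieces share at most one point, and in a parametrization pieces are intervals,
    so consecutive pieces abut and advance in one direction. The same disjointness keeps inner
    vertices away from [0] and [1]. The estimate at the corner rests on signs. In the coordinate
    along the common ray, the copies on one side have nonnegative imaginary part and those on the
    other nonpositive, so the deviations from the apices cannot cancel and are controlled by the
    distance itself. The point [z p], limit of the copies, is treated as a copy of scale 0; there
    [1 <= t] and the bound 1 on the scales supply an inequality that the hypothesis does not
    contain. *)

Section ComplexPlane.
Variable R : realType.
Implicit Types (u v w a b c : R[i]) (A : set R[i]).

(** * Modulus, topology and diameters in the plane *)

Lemma normc_ge0 w : 0 <= normc w.
Proof. by case: w => x y; apply: sqrtr_ge0. Qed.

Lemma normc_eq0 w : (normc w == 0) = (w == 0).
Proof.
by apply/eqP/eqP => [/Normc.eq0_normc //|->]; exact: Normc.normc0.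
Qed.

Lemma normc_gt0 w : (0 < normc w) = (w != 0).
Proof. by rewrite lt_neqAle eq_sym normc_eq0 normc_ge0 andbT. Qed.

Lemma normcBC u v : normc (u - v) = normc (v - u).
Proof. by rewrite -(opprB v u) normcN. Qed.

Lemma normcX w n : normc (w ^+ n) = normc w ^+ n.
Proof.
by elim: n => [|n IH]; [exact: Normc.normc1|rewrite !exprS Normc.normcM IH].
Qed.

Lemma normc_real (x : R) : normc x%:C = `|x|.
Proof. by rewrite /= expr0n addr0 sqrtr_sqr. Qed.

Lemma le_normcB u v w : normc (u - w) <= normc (u - v) + normc (v - w).
Proof. by rewrite -[u - w](subrKA v); apply: le_normcD. Qed.

Lemma ler_Re_normc w : `|complex.Re w| <= normc w.
Proof.
by case: w => x y /=; rewrite -sqrtr_sqr ler_wsqrtr // lerDl sqr_ge0.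
Qed.

Lemma ler_Im_normc w : `|complex.Im w| <= normc w.
Proof.
by case: w => x y /=; rewrite -sqrtr_sqr ler_wsqrtr // lerDr sqr_ge0.
Qed.

Lemma ReB u v : complex.Re (u - v) = complex.Re u - complex.Re v.
Proof. by case: u; case: v. Qed.

Lemma ImB u v : complex.Im (u - v) = complex.Im u - complex.Im v.
Proof. by case: u; case: v. Qed.

Lemma ImD u v : complex.Im (u + v) = complex.Im u + complex.Im v.
Proof. by case: u; case: v. Qed.

Lemma Im_realM (x : R) w : complex.Im (x%:C * w) = x * complex.Im w.
Proof. by case: w => a b /=; rewrite mul0r addr0. Qed.

Lemma nbhs_normcP w A :
  nbhs w A <-> exists2 e : R, 0 < e & forall v, normc (w - v) < e -> A v.
Proof.
rewrite nbhs_ballP; split=> [[e /= e0 eA]|[e e0 eA]].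
  have eE : e = (complex.Re e)%:C by rewrite RRe_real // gtr0_real.
  exists (complex.Re e); first by rewrite -ltcR -eE.
  by move=> v wv; apply: eA; rewrite -ball_normE /= eE ltcR.
exists e%:C; first by rewrite /= ltcR.
by move=> v; rewrite -ball_normE /= ltcR; apply: eA.
Qed.

Lemma continuous_normc_ball (f : R[i] -> R) :
  (forall u v, `|f u - f v| <= normc (u - v)) -> continuous f.
Proof.
move=> f1 w B /nbhs_ballP [e e0 eB]; apply/nbhs_normcP; exists e => // v wv.
by apply: eB; rewrite -ball_normE /=; apply: le_lt_trans wv.
Qed.

Lemma Re_continuous : continuous (@complex.Re R).
Proof. by apply: continuous_normc_ball => u v; rewrite -ReB ler_Re_normc. Qed.

Lemma Im_continuous : continuous (@complex.Im R).
Proof. by apply: continuous_normc_ball => u v; rewrite -ImB ler_Im_normc. Qed.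

Lemma normc_continuous : continuous (fun w : R[i] => normc w).
Proof.
apply: continuous_normc_ball => u v; rewrite ler_norml lerBrDr lerBlDr.
apply/andP; split.
  rewrite addrC lerBlDr normcBC.
  by have := le_normcD (v - u) u; rewrite subrK addrC.
by have := le_normcD (u - v) v; rewrite subrK.
Qed.

Lemma affine_continuous a b : continuous (fun w => a * w + b).
Proof.
move=> w A /nbhs_normcP [e e0 eA]; apply/nbhs_normcP.
exists (e / (normc a + 1)).
  by rewrite divr_gt0 // ltr_wpDl ?normc_ge0.
move=> v; rewrite ltr_pdivlMr ?ltr_wpDl ?normc_ge0 // => wv; apply: eA.
have -> : a * w + b - (a * v + b) = a * (w - v) by ring.
rewrite Normc.normcM mulrC; apply: le_lt_trans wv.
by rewrite ler_wpM2l ?normc_ge0 // lerDl.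
Qed.

Lemma closed_normcP A w : closed A ->
  (forall e : R, 0 < e -> exists2 v, A v & normc (w - v) < e) -> A w.
Proof.
move=> cA wA; apply: cA => B /nbhs_normcP [e /wA[v Av wv] eB].
by exists v; split=> //; apply: eB.
Qed.

Lemma compact_closed_plane A : compact A -> closed A.
Proof. by apply: compact_closed; exact: norm_hausdorff. Qed.

Lemma compact_bounded_plane A : compact A ->
  exists2 M : R, 0 < M & forall w, A w -> normc w <= M.
Proof.
move=> cA; have := continuous_subspaceT (A := A) normc_continuous.
move=> /continuous_compact /(_ cA) /compact_bounded [M [_ MA]].
exists (`|M| + 1) => [|w Aw]; first by rewrite ltr_wpDl.
have MM : M < `|M| + 1 by rewrite (le_lt_trans (ler_norm M)) // ltrDl.
rewrite -[X in X <= _]ger0_norm ?normc_ge0 //; apply: (MA _ MM).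
by exists w.
Qed.

Lemma argc_real (x : R) : 0 < x -> argc x%:C = 0.
Proof.
by move=> x0; rewrite /argc lexx normc_real gtr0_norm //= divff ?gt_eqF ?acos1.
Qed.

Lemma argc_eq0 w : argc w = 0 -> w = (normc w)%:C.
Proof.
have [-> _|w0 a0] := eqVneq w 0; first by rewrite Normc.normc0.
by have [_ {1}->] := argcP w0; rewrite a0 cos0 sin0 mulr1 mulr0.
Qed.

Lemma diam_le A (M : R) : A !=set0 ->
  (forall u v, A u -> A v -> normc (u - v) <= M) -> diam A <= M.
Proof.
move=> [w Aw] AM; apply: ge_sup; first by exists (normc (w - w)), w => //; exists w.
by move=> _ [u Au [v Av <-]]; exact: AM.
Qed.

Lemma diam_ge A (M : R) u v : (forall w, A w -> normc w <= M) ->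
  A u -> A v -> normc (u - v) <= diam A.
Proof.
move=> AM Au Av; apply: ub_le_sup; last by exists u => //; exists v.
exists (M + M) => _ [x Ax [y Ay <-]].
by rewrite (le_trans (le_normcD _ _)) // normcN lerD ?AM.
Qed.

End ComplexPlane.

(** * Injective paths in the line with at most one common value *)

Section UnitInterval.
Variable R : realType.
Implicit Types (phi psi : R -> R) (s t : R).

(** Models a piece of the arc read in a chart. Such a map is monotone, so its image is the interval
    between [phi 0] and [phi 1], in an order not known in advance; hence [Num.min] and [Num.max]
    below. *)
Definition unit_embedding phi : Prop :=
  {within `[0, 1], continuous phi} /\ {in `[0, 1] &, injective phi}.

Definition overlap_le1 phi psi : Prop :=
  forall s1 s2 t1 t2, s1 \in `[0, 1] -> s2 \in `[0, 1] ->
    t1 \in `[0, 1] -> t2 \in `[0, 1] ->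
    phi s1 = psi t1 -> phi s2 = psi t2 -> phi s1 = phi s2.

Let in0 : (0 : R) \in `[0, 1]. Proof. by rewrite in_itv /= lexx ler01. Qed.
Let in1 : (1 : R) \in `[0, 1]. Proof. by rewrite in_itv /= lexx ler01. Qed.

Lemma unit_embedding_ivt phi y : unit_embedding phi ->
  Num.min (phi 0) (phi 1) <= y <= Num.max (phi 0) (phi 1) ->
  exists2 s, s \in `[0, 1] & phi s = y.
Proof. by case=> cphi _; apply: IVT. Qed.

Lemma unit_embedding_bounds phi s : unit_embedding phi -> s \in `[0, 1] ->
  Num.min (phi 0) (phi 1) <= phi s <= Num.max (phi 0) (phi 1).
Proof.
case=> cphi iphi sI; move: (sI); rewrite in_itv /= => /andP[s0 s1].
rewrite ge_min le_max.
have [/le_mono_in mphi|/le_nmono_in mphi] := itv_continuous_inj_mono cphi iphi.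
  by rewrite !mphi // s0 s1 orbT.
by rewrite !mphi // s0 s1 orbT.
Qed.

Lemma unit_embedding_neq phi : unit_embedding phi -> phi 0 != phi 1.
Proof.
by case=> _ iphi; apply/eqP => /(iphi _ _ in0 in1)/eqP; rewrite lt_eqF.
Qed.

Lemma overlap_le1_eq phi psi c d : unit_embedding phi -> unit_embedding psi ->
  overlap_le1 phi psi ->
  Num.min (phi 0) (phi 1) <= c <= Num.max (phi 0) (phi 1) ->
  Num.min (psi 0) (psi 1) <= c <= Num.max (psi 0) (psi 1) ->
  Num.min (phi 0) (phi 1) <= d <= Num.max (phi 0) (phi 1) ->
  Num.min (psi 0) (psi 1) <= d <= Num.max (psi 0) (psi 1) -> c = d.
Proof.
move=> ephi epsi o /(unit_embedding_ivt ephi)[s1 ? <-].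
move=> /(unit_embedding_ivt epsi)[t1 ? e1].
move=> /(unit_embedding_ivt ephi)[s2 ? <-].
move=> /(unit_embedding_ivt epsi)[t2 ? e2].
by apply: o (esym e1) (esym e2).
Qed.

(** The intersection runs from [max m n] to [min M N], and both of these equal [c]; were [c] neither
    [m] nor [M], then [n = c = N]. *)
Lemma itv_meet_endpoint (m M n N c : R) : m <= c <= M -> n <= c <= N -> n < N ->
  (forall d, m <= d <= M -> n <= d <= N -> c = d) -> c = m \/ c = M.
Proof.
case/andP=> mc cM /andP[nc cN] nN eq.
have [->|cm] := eqVneq c m; [by left|right; apply/eqP; apply: contraT => cM'].
have cE : c = Num.min M N.
  apply: eq; first by rewrite le_min ge_min (le_trans mc cM) (le_trans mc cN) lexx.
  by rewrite le_min ge_min (le_trans nc cM) (le_trans nc cN) lexx orbT.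
have cE' : c = Num.max m n.
  apply: eq; first by rewrite le_max ge_max (le_trans mc cM) (le_trans nc cM) lexx.
  by rewrite le_max ge_max (le_trans mc cN) (le_trans nc cN) lexx orbT.
move: cE' cE nN; rewrite /Order.max /Order.min; case: ifP => _ cE'; last first.
  by rewrite cE' eqxx in cm.
case: ifP => _ cE; first by rewrite cE eqxx in cM'.
by rewrite -cE -cE' ltxx.
Qed.

Lemma overlap_le1_endpoint phi psi s t :
  unit_embedding phi -> unit_embedding psi -> overlap_le1 phi psi ->
  s \in `[0, 1] -> t \in `[0, 1] -> phi s = psi t -> s = 0 \/ s = 1.
Proof.
move=> ephi epsi o sI tI e.
have Bphi := unit_embedding_bounds ephi sI.
have := unit_embedding_bounds epsi tI; rewrite -e => Bpsi.
have npsi := unit_embedding_neq epsi; have [_ iphi] := ephi.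
have : phi s = Num.min (phi 0) (phi 1) \/ phi s = Num.max (phi 0) (phi 1).
  apply: (itv_meet_endpoint Bphi Bpsi) => [|d d1 d2].
    rewrite /Order.min /Order.max.
    by move: npsi; rewrite neq_lt => /orP[] l; rewrite ?l ?(lt_gtF l).
  exact: overlap_le1_eq ephi epsi o Bphi Bpsi d1 d2.
rewrite /Order.min /Order.max; case: ifP => _.
  by case=> /iphi -> //; [left|right].
by case=> /iphi -> //; [right|left].
Qed.

(** If [psi] turned back, both images would contain everything from [max (phi 0) (psi 1)] up to the
    common value [phi 1 = psi 0]. *)
Lemma overlap_le1_increasing phi psi :
  unit_embedding phi -> unit_embedding psi -> overlap_le1 phi psi ->
  phi 0 < phi 1 -> phi 1 = psi 0 -> psi 0 < psi 1.
Proof.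
move=> ephi epsi o lphi e; rewrite ltNge; apply/negP => psi10.
have npsi := unit_embedding_neq epsi.
have {npsi}psi10 : psi 1 < psi 0 by rewrite lt_neqAle eq_sym npsi.
suff c : phi 1 = Num.max (phi 0) (psi 1).
  move: c lphi psi10; rewrite -e /Order.max; case: ifP => _ <-; last by rewrite ltxx.
  by rewrite ltxx.
have psi01 : (psi 0 < psi 1) = false by apply: lt_gtF.
apply: (overlap_le1_eq ephi epsi o);
  rewrite /Order.min /Order.max ?lphi ?psi01; do ?case: ifP => ?; lra.
Qed.

End UnitInterval.

(** * Charts of an arc and its order *)

Section Charts.
Variable R : realType.
Implicit Types (f : R -> R[i]) (g : R[i] -> R) (A : set R[i]).

(** The inverse is kept explicit because comparing values of [g] amounts to comparing positions on
    the arc. *)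
Record arc_chart f g A : Prop := ArcChart {
  chart_mem : forall s, s \in `[0, 1] -> A (f s);
  chart_itv : forall w, A w -> g w \in `[0, 1];
  chartK : forall s, s \in `[0, 1] -> g (f s) = s;
  chartVK : forall w, A w -> f (g w) = w;
  chart_cont : {within `[0, 1], continuous f};
  chartV_cont : {within A, continuous g}
}.

Lemma arc_homeomorphism_chart f A :
  arc_homeomorphism f A -> exists g, arc_chart f g A.
Proof.
case=> [[fA fI fS]] cf [g cg gK]; exists g; split=> //.
- by move=> w /fS[s /= sI <-]; rewrite gK // -[_ <= _ <= _]/(s \in `[0, 1]).
- by move=> w /fS[s /= sI <-]; rewrite gK //; move: sI; rewrite in_itv.
Qed.

Lemma chart_arc_homeomorphism f g A : arc_chart f g A -> arc_homeomorphism f A.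
Proof.
case=> fA gI fK gK cf cg; split=> //.
  split=> [s /= /fA //|s t|w Aw].
    by rewrite !inE /= => /fK {2}<- /fK {2}<- ->.
  by exists (g w); [exact: gI|exact: gK].
by exists g => // s s01; apply: fK; rewrite in_itv.
Qed.

Lemma within_continuous_compose (U V W : topologicalType) (A : set U)
    (B : set V) (h : U -> V) (k : V -> W) : (forall x, A x -> B (h x)) ->
  {within A, continuous h} -> {within B, continuous k} ->
  {within A, continuous (k \o h)}.
Proof.
move=> hB /subspace_continuousP ch /subspace_continuousP ck.
apply/subspace_continuousP => x Ax P Pk.
have H := ch x Ax _ (ck _ (hB _ Ax) _ Pk).
apply: (@filterS _ (nbhs x) _ _ _ _ H) => y hy Ay.
by apply: hy => //; exact: hB.
Qed.

Lemma chart_reverse f g A : arc_chart f g A ->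
  arc_chart (f \o (fun s => 1 - s)) (fun w => 1 - g w) A.
Proof.
have rI (s : R) : s \in `[0, 1] -> 1 - s \in `[0, 1].
  by rewrite !in_itv /=; lra.
have cr : continuous (fun s : R => 1 - s).
  by move=> s; apply: continuousB; [exact: cst_continuous|].
case=> fA gI fK gK cf cg; split=> /=.
- by move=> s /rI /fA.
- by move=> w /gI /rI.
- by move=> s /rI /fK ->; rewrite opprB addrC subrK.
- by move=> w Aw; rewrite opprB addrC subrK gK.
- apply: within_continuous_compose cf => [s /=|]; first exact: rI.
  exact: continuous_subspaceT.
- apply: (@within_continuous_compose _ _ _ _ setT g (fun s => 1 - s)) => //.
  exact: continuous_subspaceT.
Qed.

Lemma within_continuous_affine (V : topologicalType) (B : set V)
    (h : V -> R[i]) (a b : R[i]) :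
  {within B, continuous h} -> {within B, continuous (fun x => a * h x + b)}.
Proof.
move=> ch; have ck := continuous_subspaceT (A := setT) (@affine_continuous R a b).
by refine (within_continuous_compose _ ch ck).
Qed.

Lemma chart_affine_embedding f g A (a b : R[i]) : arc_chart f g A -> a != 0 ->
  (forall w, A w -> A (a * w + b)) ->
  unit_embedding (fun s => g (a * f s + b)).
Proof.
case=> fA gI fK gK cf cg a0 TA; split.
  refine (within_continuous_compose _ (within_continuous_affine (a := a) (b := b) cf) cg).
  by move=> s /= /fA /TA.
move=> s t sI tI e; have := congr1 f e.
rewrite !gK; try by apply/TA/fA.
by move=> /addIr /(mulfI a0) /(congr1 g); rewrite !fK.
Qed.

Lemma chart_endpoints f g A : arc_chart f g A ->
  [/\ A (f 0), A (f 1), g (f 0) = 0 & g (f 1) = 1].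
Proof.
have in0 : (0 : R) \in `[0, 1] by rewrite in_itv /= lexx ler01.
have in1 : (1 : R) \in `[0, 1] by rewrite in_itv /= lexx ler01.
by case=> fA _ fK _ _ _; split; rewrite ?fK //; apply: fA.
Qed.

Lemma arc_le_mem A a b x y : arc_le A a b x y -> A x /\ A y.
Proof.
case=> f [/arc_homeomorphism_chart[g [fA _ _ _ _ _]] _ _].
case=> s [t [s0 st t1 <- <-]]; split; apply: fA; rewrite in_itv /=; lra.
Qed.

(** The order is witnessed by some parametrization with the given ends. For another one, [f'], the
    map [g \o f'] is continuous and injective on [0,1] with values 0 and 1 at the ends, hence
    increasing, so the choice does not matter. *)
Lemma arc_leP f g A x y : arc_chart f g A -> A x -> A y ->
  arc_le A (f 0) (f 1) x y <-> g x <= g y.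
Proof.
move=> ch Ax Ay; have [fA gI fK gK cf cg] := ch; split; last first.
  move=> gxy; exists f; split=> //; first exact: chart_arc_homeomorphism ch.
  exists (g x), (g y); move: (gI x Ax) (gI y Ay).
  by rewrite !in_itv /= !gK // => /andP[? _] /andP[_ ?].
case=> f' [/arc_homeomorphism_chart[g' ch'] e0 e1].
have [fA' gI' fK' gK' cf' cg'] := ch'.
case=> s [t [s0 st t1 <- <-]].
have [_ _ g0 g1] := chart_endpoints ch.
rewrite (@segment_continuous_inj_le _ (g \o f') 0 1) //=.
- by rewrite e0 e1 g0 g1 ler01.
- by apply: (within_continuous_compose _ cf' cg) => r /= /fA'.
- move=> r1 r2 r1I r2I /(congr1 f); rewrite /= !gK; try exact: fA'.
  by move=> /(congr1 g'); rewrite !fK'.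
- by rewrite in_itv /=; lra.
- by rewrite in_itv /=; lra.
Qed.

(** The [g]-values of an affine copy of the arc form an interval, by the intermediate value theorem.
    This confines the subarc between two points of a small copy to that copy. *)
Lemma chart_affine_between f g A (a b x y w : R[i]) : arc_chart f g A ->
  (forall w, A w -> A (a * w + b)) ->
  [set a * v + b | v in A] x -> [set a * v + b | v in A] y ->
  A w -> g x <= g w -> g w <= g y -> [set a * v + b | v in A] w.
Proof.
move=> ch TA [x' Ax <-] [y' Ay <-] Aw xw wy; have [fA gI fK gK cf cg] := ch.
pose phi s := g (a * f s + b).
have cphi (s t : R) : s \in `[0, 1] -> t \in `[0, 1] ->
    {within `[s, t], continuous phi}.
  rewrite !in_itv /= => s01 t01.
  have {}cf : {within `[s, t], continuous f}.
    by apply: continuous_subspaceW cf => r /=; rewrite !in_itv /=; lra.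
  refine (within_continuous_compose _ (within_continuous_affine (a := a) (b := b) cf) cg).
  by move=> r /=; rewrite in_itv /= => r01; apply/TA/fA; rewrite in_itv /=; lra.
have [s sI e] : exists2 s, s \in `[0, 1] & phi s = g w.
  have := gI _ Ax; have := gI _ Ay; have ex := gK _ Ax; have ey := gK _ Ay.
  move: (g x') (g y') ex ey => s t ex ey tI sI.
  have [st|ts] := leP s t.
    have [||r rI er] := @IVT _ phi s t (g w) st; first exact: cphi.
      by rewrite /phi ge_min le_max ex ey xw wy !orbT.
    by exists r => //; move: sI tI rI; rewrite !in_itv /=; lra.
  have [||r rI er] := @IVT _ phi t s (g w) (ltW ts); first exact: cphi.
    by rewrite /phi ge_min le_max ex ey xw wy !orbT.
  by exists r => //; move: sI tI rI; rewrite !in_itv /=; lra.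
exists (f s); first exact: fA.
by move: (congr1 f e); rewrite /phi !gK //; apply/TA/fA.
Qed.

End Charts.

(** * Triangles: convexity, affine images, sectors *)

Section Triangles.
Variable R : realType.
Implicit Types (a b c u v w x y k d : R[i]).

Lemma triangle_vertex1 a b c : triangle a b c a.
Proof.
exists 1, 0, 0; split; rewrite ?ler01 //; first lra.
by rewrite rmorph1 rmorph0; ring.
Qed.

Lemma triangle_vertex3 a b c : triangle a b c c.
Proof.
exists 0, 0, 1; split; rewrite ?ler01 //; first lra.
by rewrite rmorph1 rmorph0; ring.
Qed.

Lemma triangle_convex a b c u v w : triangle a b c u -> triangle a b c v ->
  triangle a b c w -> triangle u v w `<=` triangle a b c.
Proof.
move=> [s1 [t1 [r1 [s10 t10 r10 e1 ->]]]] [s2 [t2 [r2 [s20 t20 r20 e2 ->]]]].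
move=> [s3 [t3 [r3 [s30 t30 r30 e3 ->]]]] _ [s [t [r [s0 t0 r0 e ->]]]].
exists (s * s1 + t * s2 + r * s3), (s * t1 + t * t2 + r * t3),
  (s * r1 + t * r2 + r * r3); split; rewrite ?addr_ge0 ?mulr_ge0 //.
  transitivity (s * (s1 + t1 + r1) + t * (s2 + t2 + r2) + r * (s3 + t3 + r3)).
    by ring.
  by rewrite e1 e2 e3 !mulr1.
rewrite !rmorphD !rmorphM /=; ring.
Qed.

Lemma triangle_affine a b c k d w : triangle a b c w ->
  triangle (k * a + d) (k * b + d) (k * c + d) (k * w + d).
Proof.
case=> s [t [r [s0 t0 r0 e ->]]]; exists s, t, r; split=> //.
have e' : (1 : R[i]) = s%:C + t%:C + r%:C by rewrite -!rmorphD e rmorph1.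
rewrite -{1}[d]mulr1 {1}e'; ring.
Qed.

Lemma interior_affine (A : set R[i]) k d w : k != 0 ->
  (forall v, A v -> A (k * v + d)) -> A° w -> A° (k * w + d).
Proof.
move=> k0 kA /nbhs_normcP[e e0 eA]; apply/nbhs_normcP.
exists (normc k * e); first by rewrite mulr_gt0 // normc_gt0.
move=> v; rewrite -ltr_pdivrMl ?normc_gt0 // -Normc.normcV -Normc.normcM => wv.
have -> : v = k * ((v - d) / k) + d by field.
apply/kA/eA; suff -> : w - (v - d) / k = k^-1 * (k * w + d - v) by [].
by field.
Qed.

(** The modulus is convex and the imaginary part linear, so the bound passes from the vertices to
    the triangle. Each vertex off [1] gives a constant, and the least of the three serves. *)
Lemma triangle_sector a b c :
  (forall w, w \in [:: a; b; c] -> w = 1 \/ 0 < complex.Im w) ->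
  exists2 m : R, 0 < m &
    forall w, triangle a b c w -> m * normc (w - 1) <= complex.Im w.
Proof.
move=> abc.
have vertex w : w \in [:: a; b; c] ->
    exists2 m : R, 0 < m & forall n, n <= m -> n * normc (w - 1) <= complex.Im w.
  case/abc => [->|w0].
    by exists 1 => // n _; rewrite subrr Normc.normc0 mulr0.
  have n0 : 0 < normc (w - 1) + 1 by rewrite ltr_wpDl ?normc_ge0.
  exists (complex.Im w / (normc (w - 1) + 1)); first by rewrite divr_gt0.
  move=> n nm; apply: le_trans (ler_wpM2r (normc_ge0 _) nm) _.
  by rewrite mulrAC ler_pdivrMr // ler_wpM2l ?lerDl // ltW.
have [|m1 m10 H1] := vertex a; first by rewrite !inE eqxx.
have [|m2 m20 H2] := vertex b; first by rewrite !inE eqxx orbT.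
have [|m3 m30 H3] := vertex c; first by rewrite !inE eqxx !orbT.
have [m [m0 l1 l2 l3]] : exists m, [/\ 0 < m, m <= m1, m <= m2 & m <= m3].
  exists (Num.min m1 (Num.min m2 m3)).
  by rewrite !lt_min !ge_min m10 m20 m30 !lexx !orbT.
exists m => // w [s [t [r [s0 t0 r0 e ->]]]].
have -> : s%:C * a + t%:C * b + r%:C * c - 1
    = s%:C * (a - 1) + t%:C * (b - 1) + r%:C * (c - 1).
  transitivity (s%:C * a + t%:C * b + r%:C * c - (s%:C + t%:C + r%:C)).
    by rewrite -!rmorphD e rmorph1.
  ring.
rewrite !ImD !Im_realM.
apply: (@le_trans _ _ (m * (s * normc (a - 1) + t * normc (b - 1) + r * normc (c - 1)))).
  rewrite ler_wpM2l ?(ltW m0) //.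
  rewrite (le_trans (le_normcD _ _)) // lerD //; last first.
    by rewrite Normc.normcM normc_real ger0_norm.
  rewrite (le_trans (le_normcD _ _)) // !Normc.normcM !normc_real.
  by rewrite !ger0_norm.
rewrite !mulrDr !(mulrCA m) !lerD // ler_wpM2l //.
- exact: H1.
- exact: H2.
- exact: H3.
Qed.

End Triangles.

(** * Barycentric coordinates in the triangle with vertices 0, 1 and the apex *)

Section StandardTriangle.
Variables (R : realType) (q : R[i]).
Hypothesis Imq : 0 < complex.Im q.
Implicit Types (w : R[i]).
Local Notation T := (triangle 0 1 q).

(** Barycentric coordinates for the vertices [0], [1], [q], in the order of their indices. The side
    from [q] to [1] lies on [bary0 = 0], the side from [q] to [0] on [bary1 = 0]. *)
Definition bary2 w : R := complex.Im w / complex.Im q.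
Definition bary1 w : R := complex.Re w - complex.Re q * bary2 w.
Definition bary0 w : R := 1 - bary1 w - bary2 w.

Let Imq0 : complex.Im q != 0. Proof. by rewrite gt_eqF. Qed.

Lemma bary_sum w : w = (bary1 w)%:C * 1 + (bary2 w)%:C * q.
Proof.
rewrite mulr1 /bary1 /bary2; case: w q Imq0 => x y [a b] /= b0.
by simpc; congr (_ +i* _); field.
Qed.

Lemma baryE (s t r : R) : s + t + r = 1 ->
  let w := s%:C * 0 + t%:C * 1 + r%:C * q in
  [/\ bary0 w = s, bary1 w = t & bary2 w = r].
Proof.
move=> e w; suff [e1 e2] : bary1 w = t /\ bary2 w = r.
  by split=> //; rewrite /bary0 e1 e2; lra.
rewrite /w /bary1 /bary2 mulr0 add0r mulr1; case: q Imq0 => a b /= b0.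
by split; simpc; field.
Qed.

Lemma triangleP w :
  T w <-> [/\ 0 <= bary0 w, 0 <= bary1 w & 0 <= bary2 w].
Proof.
split=> [[s [t [r [s0 t0 r0 e ->]]]]|[s0 t0 r0]].
  by have [-> -> ->] := baryE e.
exists (bary0 w), (bary1 w), (bary2 w); split=> //.
  by rewrite /bary0; ring.
by rewrite {1}[w]bary_sum mulr0 add0r.
Qed.

Lemma bary2_continuous : continuous bary2.
Proof.
move=> w; apply: (@continuousM R R[i] _ (fun _ => (complex.Im q)^-1)).
  exact: Im_continuous.
exact: cst_continuous.
Qed.

Lemma bary1_continuous : continuous bary1.
Proof.
move=> w; apply: (@continuousB R R R[i]); first exact: Re_continuous.
apply: (@continuousM R R[i] (fun _ => complex.Re q)); first exact: cst_continuous.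
exact: bary2_continuous.
Qed.

Lemma bary0_continuous : continuous bary0.
Proof.
move=> w; apply: (@continuousB R R R[i]); last exact: bary2_continuous.
apply: (@continuousB R R R[i]); last exact: bary1_continuous.
exact: cst_continuous.
Qed.

Lemma triangle_closed : closed T.
Proof.
have -> : T = bary0 @^-1` [set y | 0 <= y] `&` (bary1 @^-1` [set y | 0 <= y]
    `&` bary2 @^-1` [set y | 0 <= y]).
  by apply/seteqP; split=> w /=; rewrite triangleP => -[]; [|move=> ? []].
have cE (f : R[i] -> R) : continuous f -> closed (f @^-1` [set y | 0 <= y]).
  by move=> /continuous_closedP; apply; exact: closed_ge.
have c0 := cE _ bary0_continuous; have c1 := cE _ bary1_continuous.
exact: closedI c0 (closedI c1 (cE _ bary2_continuous)).
Qed.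

Lemma bary_gt0_interior w :
  0 < bary0 w -> 0 < bary1 w -> 0 < bary2 w -> T° w.
Proof.
move=> w0 w1 w2.
have oE (f : R[i] -> R) : continuous f -> 0 < f w -> \forall v \near w, 0 < f v.
  by move=> cf fw; exact: (cvgr_gt _ (cf w) _ fw).
rewrite /interior /=.
have n0 := oE _ bary0_continuous w0; have n1 := oE _ bary1_continuous w1.
have n2 := oE _ bary2_continuous w2.
apply: filterS (filterI n0 (filterI n1 n2)) => v [/ltW v0 [/ltW v1 /ltW v2]].
exact/triangleP.
Qed.

(** A real translation by [x] adds [x] to [bary1], subtracts it from [bary0] and fixes [bary2];
    small translations both ways stay in the triangle. *)
Lemma interior_bary_gt0 w : T° w -> 0 < bary0 w /\ 0 < bary1 w.
Proof.
move=> /nbhs_normcP[e e0 eT].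
have shift (x : R) : bary1 (w + x%:C) = bary1 w + x /\ bary2 (w + x%:C) = bary2 w.
  by rewrite /bary1 /bary2; case: w {eT} => a b /=; split; rewrite addr0; ring.
have mem (x : R) : `|x| < e -> T (w + x%:C).
  by move=> xe; apply: eT; rewrite opprD addNKr normcN normc_real.
have e2 : `|e / 2| < e by rewrite ger0_norm; lra.
have [s1 s2] := shift (e / 2); have [s1' s2'] := shift (- (e / 2)).
have /triangleP[+ _ _] := mem _ e2; rewrite /bary0 s1 s2 => h1.
have : T (w + (- (e / 2))%:C) by apply: mem; rewrite normrN.
case/triangleP=> _; rewrite s1' => h2 _; split; last lra.
by rewrite /bary0; lra.
Qed.

Lemma closure_interior_triangle : closure T° `<=` T.
Proof.
move=> w wT; apply: triangle_closed; apply: closure_subset wT.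
exact: interior_subset.
Qed.

Lemma bary_comb (e : R) w :
  let v := (1 - e)%:C * q + e%:C * w in
  [/\ bary0 v = e * bary0 w, bary1 v = e * bary1 w
    & bary2 v = (1 - e) + e * bary2 w].
Proof.
move=> v.
suff [e1 e2] : bary1 v = e * bary1 w /\ bary2 v = (1 - e) + e * bary2 w.
  by split=> //; rewrite /bary0 e1 e2; ring.
rewrite /v /bary1 /bary2; case: w {v} => x y; case: q Imq0 => a b /= b0.
by split; simpc; field.
Qed.

Definition centroid : R[i] :=
  (1 / 3 : R)%:C * 0 + (1 / 3 : R)%:C * 1 + (1 / 3 : R)%:C * q.

Lemma centroid_interior : T° centroid.
Proof.
have e : 1 / 3 + 1 / 3 + 1 / 3 = 1 :> R by field.
by have [c0 c1 c2] := baryE e; apply: bary_gt0_interior; rewrite ?c0 ?c1 ?c2 divr_gt0.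
Qed.

Lemma apex_closure_interior : closure T° q.
Proof.
have e : 1 / 3 + 1 / 3 + 1 / 3 = 1 :> R by field.
have [c0 c1 c2] := baryE e; rewrite -/centroid in c0 c1 c2.
move=> B /nbhs_normcP[d d0 dB].
pose n := normc (q - centroid).
have n0 : 0 <= n := normc_ge0 _.
(* Chosen so that both [s < 1] and [s * n < d]: the point is interior and within [d] of the apex. *)
pose s := d / (n + d + d).
have [s0 s1] : 0 < s /\ s < 1.
  by rewrite /s divr_gt0 ?ltr_pdivrMr ?mul1r; lra.
have [v0 v1 v2] := bary_comb s centroid.
exists ((1 - s)%:C * q + s%:C * centroid); split.
  apply: bary_gt0_interior; rewrite ?v0 ?v1 ?v2 ?c0 ?c1 ?c2.
  - by rewrite mulr_gt0 // divr_gt0.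
  - by rewrite mulr_gt0 // divr_gt0.
  - by move: s0 s1; lra.
apply: dB; rewrite rmorphB rmorph1.
have -> : q - ((1 - s%:C) * q + s%:C * centroid) = s%:C * (q - centroid) by ring.
rewrite Normc.normcM normc_real gtr0_norm // -/n /s mulrAC ltr_pdivrMr; last lra.
by rewrite ltr_pM2l //; lra.
Qed.

Lemma q_neq0 : q != 0.
Proof. by apply: contraTneq Imq => ->; rewrite ltxx. Qed.

Lemma q_neq1 : q != 1.
Proof. by apply: contraTneq Imq => ->; rewrite ltxx. Qed.

Let qB1 : q - 1 != 0. Proof. by rewrite subr_eq0 q_neq1. Qed.

(** The coordinate [(w - 1) / (q - 1)] is real on the line through [1] and [q], so its imaginary
    part is proportional to [bary0]; the factor [far0] is its value at [0]. Likewise [far1] for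
    [w / q] and [bary1], with the sign changed because the triangle then falls below the real
    axis. *)
Definition far0 : R := complex.Im ((1 - q)^-1).
Definition far1 : R := - complex.Im (q^-1).

Lemma far0_gt0 : 0 < far0.
Proof.
rewrite /far0; case: q Imq => a b /= b0; rewrite sub0r mulNr opprK sqrrN.
by rewrite divr_gt0 // ltr_wpDl ?sqr_ge0 // exprn_gt0.
Qed.

Lemma far1_gt0 : 0 < far1.
Proof.
rewrite /far1; case: q Imq => a b /= b0.
by rewrite opprK divr_gt0 // ltr_wpDl ?sqr_ge0 // exprn_gt0.
Qed.

Lemma Im_ratio0 w : complex.Im ((w - 1) / (q - 1)) = bary0 w * far0.
Proof.
rewrite /far0 -Im_realM.
have -> : (w - 1) / (q - 1) = (bary2 w)%:C + (bary0 w)%:C * (1 - q)^-1.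
  rewrite {1}[w]bary_sum /bary0 !rmorphB rmorph1.
  have q1B : 1 - q != 0 by rewrite -opprB oppr_eq0.
  by field; rewrite ?qB1 ?q1B.
by rewrite ImD /= add0r.
Qed.

Lemma Im_ratio1 w : complex.Im (w / q) = - (bary1 w * far1).
Proof.
rewrite /far1 mulrN opprK -Im_realM.
have -> : w / q = (bary2 w)%:C + (bary1 w)%:C * q^-1.
  by rewrite {1}[w]bary_sum mulr1; field; exact: q_neq0.
by rewrite ImD /= add0r.
Qed.

Lemma bary0_eq0 w : T w -> bary0 w = 0 -> segment q 1 w.
Proof.
move=> /triangleP[_ t1 t2] e; exists (bary1 w); split.
  by move: e; rewrite /bary0; lra.
have e2 : bary2 w = 1 - bary1 w by move: e; rewrite /bary0; lra.
by rewrite {1}[w]bary_sum e2 addrC.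
Qed.

Lemma bary1_eq0 w : T w -> bary1 w = 0 -> segment q 0 w.
Proof.
move=> /triangleP[t0 _ t2] e; exists (1 - bary2 w); split.
  by move: t0; rewrite /bary0 e; lra.
by rewrite {1}[w]bary_sum e rmorph0 mul0r add0r mulr0 addr0 subKr.
Qed.

End StandardTriangle.

(** * Position of the small triangles in a basic figure *)

Section BasicFigures.
Variables (R : realType) (ell q : nat) (z : nat -> R[i]).
Hypotheses (hbf : basic_figure ell q z) (hz0 : z 0%N = 0) (hz1 : z ell = 1).
Hypothesis hzq : 0 < complex.Im (z q).
Implicit Types (w : R[i]) (j : nat).

Local Notation T := (triangle 0 1 (z q)).
Local Notation S := (simil ell z).
Local Notation a := (simil_coef ell z).
Local Notation r := (simil_ratio ell z).

Lemma coefE j : a j = z j - z j.-1.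
Proof. by rewrite /simil_coef hz0 hz1 subr0 divr1. Qed.

Lemma similE j w : S j w = a j * w + z j.-1.
Proof. by rewrite /simil hz0 mulr0 subr0. Qed.

Lemma similE1 j w : S j w = a j * (w - 1) + z j.
Proof. by rewrite similE coefE; ring. Qed.

Lemma simil_at0 j : S j 0 = z j.-1.
Proof. by rewrite similE mulr0 add0r. Qed.

Lemma simil_at1 j : S j 1 = z j.
Proof. by rewrite similE1 subrr mulr0 add0r. Qed.

Lemma coef_neq0 j : (1 <= j <= ell)%N -> a j != 0.
Proof. by move=> /(bf_sides hbf); rewrite coefE subr_eq0 eq_sym. Qed.

Lemma ratio_gt0 j : (1 <= j <= ell)%N -> 0 < r j.
Proof. by move=> /coef_neq0; rewrite /simil_ratio normc_gt0. Qed.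

Lemma apex_range : (0 < q < ell)%N.
Proof.
have q0 : q != 0%N by apply: contraTneq hzq => ->; rewrite hz0 ltxx.
have ql : q != ell by apply: contraTneq hzq => ->; rewrite hz1 ltxx.
by rewrite lt0n q0 ltn_neqAle ql (bf_apex hbf).
Qed.

Lemma Pi1_triangle w : Pi1 ell q z w -> T w.
Proof.
by rewrite /Pi1 /Pi0 hz0 hz1 => /(@closure_interior_triangle _ _ hzq).
Qed.

Lemma vertex_triangle j : (j <= ell)%N -> T (z j).
Proof.
move=> /(bf_vertices hbf); rewrite /Pi /Pi0 hz0 hz1 => -[[->|]|/interior_subset //].
  exact: triangle_vertex3.
case=> s [/andP[s0 s1] ->]; exists (1 - s), s, 0; split; rewrite ?subr_ge0 //.
  by ring.
by rewrite rmorph0 mul0r addr0.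
Qed.

Lemma simil_triangle j : (1 <= j <= ell)%N -> forall w, T w -> T (S j w).
Proof.
move=> jl w /(triangle_affine (a j) (z j.-1)); rewrite -!similE simil_at0 simil_at1.
apply: triangle_convex.
- by apply: vertex_triangle; lia.
- by apply: vertex_triangle; lia.
- exact/Pi1_triangle/(bf_inside hbf).
Qed.

(** A nonconstant affine map is open, so a copy of the triangle inside [S i T] has its centroid in
    the image of the open triangle; the same for [j] contradicts disjointness. *)
Lemma no_common_copy i j (k d : R[i]) :
  (1 <= i <= ell)%N -> (1 <= j <= ell)%N -> i != j -> k != 0 ->
  (forall v, T v -> exists2 u, T u & k * v + d = S i u) ->
  (forall v, T v -> exists2 u, T u & k * v + d = S j u) -> False.
Proof.
move=> il jl ij k0 Ti Tj.
have mem n : (1 <= n <= ell)%N ->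
    (forall v, T v -> exists2 u, T u & k * v + d = S n u) ->
    (S n @` Pi0 ell q z) (k * centroid (z q) + d).
  move=> nl Tn; have a0 := coef_neq0 nl.
  (* The preimage under [S n] of the centroid of the copy. *)
  exists ((k / a n) * centroid (z q) + (d - z n.-1) / a n); last first.
    by rewrite similE; field.
  rewrite /Pi0 hz0 hz1; apply: interior_affine.
  - by rewrite mulf_neq0 ?invr_eq0.
  - move=> v /Tn[u Tu e]; suff -> : k / a n * v + (d - z n.-1) / a n = u by [].
    have {}e : d = a n * u + z n.-1 - k * v.
      by rewrite -similE -e [k * v + d]addrC addrK.
    by rewrite e; field.
  - exact: centroid_interior.
have : set0 (k * centroid (z q) + d).
  by rewrite -(bf_disjoint hbf il jl ij); split; exact: mem.
by [].
Qed.

(* If [z j = 1] then [S j] and [S ell] both fix [1], hence commute, and the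
   copy [S j (S ell T)] of the triangle lies in both [S j T] and [S ell T]. *)
Lemma vertex_neq1 j : (j < ell)%N -> z j != 1.
Proof.
move=> jl; have [-> |j0] := posnP j; first by rewrite hz0 eq_sym oner_eq0.
have jr : (1 <= j <= ell)%N by lia.
have lr : (1 <= ell <= ell)%N by lia.
apply/eqP => zj1; have jl' : j != ell by rewrite neq_ltn jl.
have comm w : S j (S ell w) = S ell (S j w).
  by rewrite !similE1 zj1 hz1; ring.
apply: (no_common_copy (k := a j * a ell) (d := a j * z ell.-1 + z j.-1) jr lr jl').
- by rewrite mulf_neq0 ?coef_neq0.
- move=> v Tv; exists (S ell v); first exact: simil_triangle.
  by rewrite !similE; ring.
- move=> v Tv; exists (S j v); first exact: simil_triangle.
  by rewrite -comm !similE; ring.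
Qed.

(** The map whose base point is [z j] is [S j.+1]: with [z j = 0] it fixes [0] together with [S 1],
    and the two commute. *)
Lemma vertex_neq0 j : (0 < j <= ell)%N -> z j != 0.
Proof.
case/andP=> j0; rewrite leq_eqVlt => /predU1P[->|jl].
  by rewrite hz1 oner_eq0.
have jr : (1 <= j.+1 <= ell)%N by lia.
have lr : (1 <= 1 <= ell)%N by lia.
apply/eqP => zj0; have jl' : j.+1 != 1%N by lia.
have comm w : S j.+1 (S 1%N w) = S 1%N (S j.+1 w).
  by rewrite !similE /= zj0 hz0; ring.
apply: (no_common_copy (k := a j.+1 * a 1%N) (d := a j.+1 * z 0%N + z j) jr lr jl').
- by rewrite mulf_neq0 ?coef_neq0.
- move=> v Tv; exists (S 1%N v); first exact: simil_triangle.
  by rewrite !similE /=; ring.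
- move=> v Tv; exists (S j.+1 v); first exact: simil_triangle.
  by rewrite -comm !similE /=; ring.
Qed.

(** As [z 1] lies on the segment from [0] to [1], its coordinate there is the coefficient: [S 1] is
    a homothety centred at [0], and similarly [S ell] at [1]. *)
Lemma coef_first : (0 < ell)%N -> a 1%N = (r 1%N)%:C /\ 0 < r 1%N < 1.
Proof.
move=> l0; have lr : (1 <= 1 <= ell)%N by [].
rewrite ratio_gt0 ?(bf_contractive hbf) //; split=> //.
have [s [/andP[s0 _] e]] := bf_first hbf.
have aE : a 1%N = s%:C by rewrite coefE e hz0 hz1; ring.
by rewrite /simil_ratio aE normc_real ger0_norm.
Qed.

Lemma coef_last : (0 < ell)%N -> a ell = (r ell)%:C /\ 0 < r ell < 1.
Proof.
move=> l0; have lr : (1 <= ell <= ell)%N by rewrite l0 leqnn.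
rewrite ratio_gt0 ?(bf_contractive hbf) //; split=> //.
have [s [/andP[_ s1] e]] := bf_last hbf.
have aE : a ell = (1 - s)%:C by rewrite coefE e hz0 hz1 rmorphB rmorph1; ring.
by rewrite /simil_ratio aE normc_real ger0_norm // subr_ge0.
Qed.

(** A vertex is the apex, a point of the base, or interior; on the base [bary0] vanishes only at
    [1], excluded by [vertex_neq1]. *)
Lemma vertex_bary0 j : (j < ell)%N -> z j = z q \/ 0 < bary0 (z q) (z j).
Proof.
move=> jl; have zj1 := vertex_neq1 jl.
have := bf_vertices hbf (ltnW jl); rewrite /Pi /Pi0 hz0 hz1 => -[[->|]|]; first by left.
  case=> s [/andP[_ s1] e]; right.
  have -> : z j = (1 - s)%:C * 0 + s%:C * 1 + 0%:C * z q.
    by rewrite e rmorph0 mul0r addr0.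
  have [-> _ _] := @baryE _ _ hzq (1 - s) s 0 (ltac:(ring)).
  rewrite subr_gt0 lt_neqAle s1 andbT; apply: contraNneq zj1 => s1'.
  by rewrite e s1' subrr rmorph0 rmorph1 mul0r add0r mulr1.
by move=> /(interior_bary_gt0 hzq)[]; right.
Qed.

Lemma vertex_bary1 j : (0 < j <= ell)%N -> z j = z q \/ 0 < bary1 (z q) (z j).
Proof.
move=> jl; have zj0 := vertex_neq0 jl; have /andP[_ jl'] := jl.
have := bf_vertices hbf jl'; rewrite /Pi /Pi0 hz0 hz1 => -[[->|]|]; first by left.
  case=> s [/andP[s0 _] e]; right.
  have -> : z j = (1 - s)%:C * 0 + s%:C * 1 + 0%:C * z q.
    by rewrite e rmorph0 mul0r addr0.
  have [_ -> _] := @baryE _ _ hzq (1 - s) s 0 (ltac:(ring)).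
  rewrite lt_neqAle s0 andbT eq_sym; apply: contraNneq zj0 => s0'.
  by rewrite e s0' rmorph0 mul0r mulr0 addr0.
by move=> /(interior_bary_gt0 hzq)[]; right.
Qed.

Lemma simil_apex_off_sides j : (1 <= j <= ell)%N ->
  j \notin [:: 1%N; ell; q; q.+1] ->
  ~ (segment (z q) 0 (S j (z q)) \/ segment (z q) 1 (S j (z q))).
Proof.
move=> jl jn seg; suff : set0 (S j (z q)) by [].
rewrite -(bf_off_sides hbf jl jn); split; last by rewrite hz0 hz1.
exists (z q) => //; rewrite /Pi1 /Pi0 hz0 hz1; exact: apex_closure_interior.
Qed.

Lemma bary_apexDr (s : R) :
  bary0 (z q) (z q + s%:C) = - s /\ bary1 (z q) (z q + s%:C) = s.
Proof.
have h : complex.Im (z q) != 0 by rewrite gt_eqF.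
suff [e1 e2] : bary1 (z q) (z q + s%:C) = s /\ bary2 (z q) (z q + s%:C) = 1.
  by rewrite /bary0 e1 e2; split=> //; ring.
rewrite /bary1 /bary2; case: (z q) h => x y /= y0.
by rewrite addr0; split; field.
Qed.

(** Suppose the image of the apex is on the side from [z q] to [1]. The axiom on sides leaves [j]
    equal to [1], [q] or [q.+1]. For [1] the image is on the other side, below the apex; for [q] it
    must be the apex, or [z q.-1] would leave the triangle; for [q.+1] the angle [eta2] would
    vanish. *)
Lemma simil_apex_bary0 j : 0 < eta2 ell q z -> (1 <= j < ell)%N ->
  S j (z q) = z q \/ 0 < bary0 (z q) (S j (z q)).
Proof.
move=> eta /andP[j1 jl].
have jr : (1 <= j <= ell)%N by rewrite j1 ltnW.
have TS : T (S j (z q)) by apply: simil_triangle => //; exact: triangle_vertex3.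
have [b0 _ _] := (triangleP hzq _).1 TS.
have [e|ne] := eqVneq (bary0 (z q) (S j (z q))) 0; last first.
  by right; rewrite lt_neqAle eq_sym ne.
have zq0 := q_neq0 hzq; have /andP[q0 ql] := apex_range.
have [s [/andP[s0 _] Es]] := bary0_eq0 hzq TS e.
have {}Es : S j (z q) = z q + s%:C * (1 - z q).
  by rewrite Es rmorphB rmorph1; ring.
have [E|jn] := boolP (j \in [:: 1%N; ell; q; q.+1]); last first.
  exfalso; apply: (simil_apex_off_sides jr jn); right; exact: bary0_eq0.
move: E; rewrite !inE => /or4P[/eqP E|/eqP E|/eqP E|/eqP E].
- move: e; have [aE /andP[_ r1]] := coef_first (leq_trans j1 (ltnW jl)).
  have -> : S j (z q) = (1 - r 1%N)%:C * 0 + 0%:C * 1 + (r 1%N)%:C * z q.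
    by rewrite E similE aE /= hz0 rmorph0; ring.
  have [-> _ _] := @baryE _ _ hzq (1 - r 1%N) 0 (r 1%N) (ltac:(ring)).
  by move=> e; move: r1; lra.
- by rewrite E ltnn in jl.
- have [s0'|sn] := eqVneq s 0; first by left; rewrite Es s0' rmorph0 mul0r addr0.
  (* Since [S q] sends [1] to [z q], [Es] determines its coefficient. Then [z q.-1] is [z q + s],
     level with the apex and outside the triangle. *)
  exfalso; have aE : a q = (- s)%:C.
    have q1 : z q - 1 != 0 by rewrite subr_eq0 q_neq1.
    apply: (mulIf q1); apply: (addIr (z q)).
    by rewrite -similE1 -[LHS](congr1 (S^~ (z q)) E) Es rmorphN; ring.
  have /(triangleP hzq)[] : T (z q.-1) by apply: vertex_triangle; lia.
  have -> : z q.-1 = z q + s%:C.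
    transitivity (z q - a q); first by rewrite coefE; ring.
    by rewrite aE rmorphN opprK.
  have [-> _] := bary_apexDr s; rewrite oppr_ge0 => s0' _ _.
  by move/eqP: sn; apply; apply/le_anti; rewrite s0 s0'.
- have sn : s != 0.
    apply: contraTneq (coef_neq0 jr) => s0'; rewrite negbK.
    move: Es; rewrite s0' rmorph0 mul0r addr0 E similE /=.
    by move=> /eqP; rewrite -subr_eq0 addrK mulf_eq0 (negPf zq0) orbF.
  (* The image of the apex is displaced from it by a positive multiple of [1 - z q], so the angle
     [eta2] is 0. *)
  exfalso; move: eta; rewrite /eta2 hz1 -(congr1 (S^~ (z q)) E) /= Es.
  have -> : (1 - z q) / (z q + s%:C * (1 - z q) - z q) = (s^-1)%:C.
    have q1 : 1 - z q != 0 by rewrite subr_eq0 eq_sym q_neq1.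
    by rewrite [z q + _]addrC addrK invfM mulrCA divff // mulr1 fmorphV.
  by rewrite argc_real ?ltxx // invr_gt0 lt_neqAle eq_sym sn.
Qed.

(** Mirror image of [simil_apex_bary0]: here [eta1] settles [j = q], and [j = q.+1] would push
    [z q.+1] out of the triangle to the left of the apex. *)
Lemma simil_apex_bary1 j : 0 < eta1 ell q z -> (1 < j <= ell)%N ->
  S j (z q) = z q \/ 0 < bary1 (z q) (S j (z q)).
Proof.
move=> eta /andP[j1 jl].
have jr : (1 <= j <= ell)%N by rewrite ltnW.
have TS : T (S j (z q)) by apply: simil_triangle => //; exact: triangle_vertex3.
have [_ b1 _] := (triangleP hzq _).1 TS.
have [e|ne] := eqVneq (bary1 (z q) (S j (z q))) 0; last first.
  by right; rewrite lt_neqAle eq_sym ne.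
have q1 : z q - 1 != 0 by rewrite subr_eq0 q_neq1.
have zq0 := q_neq0 hzq; have /andP[q0 ql] := apex_range.
have [s [/andP[s0 _] Es]] := bary1_eq0 hzq TS e.
have {}Es : S j (z q) = z q - s%:C * z q.
  by rewrite Es rmorphB rmorph1; ring.
have [E|jn] := boolP (j \in [:: 1%N; ell; q; q.+1]); last first.
  exfalso; apply: (simil_apex_off_sides jr jn); left; exact: bary1_eq0.
move: E; rewrite !inE => /or4P[/eqP E|/eqP E|/eqP E|/eqP E].
- by rewrite E ltnn in j1.
- move: e; have [aE /andP[_ r1]] := coef_last (leq_trans (ltnW j1) jl).
  have -> : S j (z q) = 0%:C * 0 + (1 - r ell)%:C * 1 + (r ell)%:C * z q.
    by rewrite E similE1 aE /= hz1 rmorph0 rmorphB rmorph1; ring.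
  have [_ -> _] := @baryE _ _ hzq 0 (1 - r ell) (r ell) (ltac:(ring)).
  by move=> e; move: r1; lra.
- have sn : s != 0.
    apply: contraTneq (coef_neq0 jr) => s0'; rewrite negbK.
    move: Es; rewrite s0' rmorph0 mul0r subr0 E similE1 /=.
    by move=> /eqP; rewrite -subr_eq0 addrK mulf_eq0 (negPf q1) orbF.
  exfalso; move: eta; rewrite /eta1 hz0 -(congr1 (S^~ (z q)) E) /= Es.
  have -> : (z q - s%:C * z q - z q) / (0 - z q) = s%:C.
    by field; rewrite ?oppr_eq0.
  by rewrite argc_real ?ltxx // lt_neqAle eq_sym sn.
- have [s0'|sn] := eqVneq s 0; first by left; rewrite Es s0' rmorph0 mul0r subr0.
  exfalso; have aE : a q.+1 = (- s)%:C.
    apply: (mulIf zq0); apply: (addIr (z q)).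
    rewrite -[X in _ + X]/(z q.+1.-1) -similE.
    by rewrite -[LHS](congr1 (S^~ (z q)) E) Es rmorphN /=; ring.
  have /(triangleP hzq)[] : T (z q.+1) by apply: vertex_triangle; lia.
  have -> : z q.+1 = z q + (- s)%:C.
    by rewrite -aE coefE /=; ring.
  have [_ ->] := bary_apexDr (- s); rewrite oppr_ge0 => _ s0' _.
  by move/eqP: sn; apply; apply/le_anti; rewrite s0 s0'.
Qed.

Lemma exists_uniform (n : nat) (P : nat -> R -> Prop) :
  (forall j m m', 0 < m' -> m' <= m -> P j m -> P j m') ->
  (forall j, (j < n)%N -> exists2 m, 0 < m & P j m) ->
  exists2 m, 0 < m & forall j, (j < n)%N -> P j m.
Proof.
move=> mono; elim: n => [|n IH] H; first by exists 1.
have [|m m0 Hm] := IH; first by move=> j jn; apply: H; rewrite ltnS ltnW.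
have [m' m'0 Hm'] := H n (ltnSn n).
exists (Num.min m m'); first by rewrite lt_min m0 m'0.
move=> j; rewrite ltnS leq_eqVlt => /predU1P[->|jn].
  by apply: mono Hm'; rewrite ?lt_min ?m0 // ge_min lexx orbT.
by apply: mono (Hm j jn); rewrite ?lt_min ?m0 // ge_min lexx.
Qed.

(** In the coordinate [(w - 1) / (z q - 1)] the apex is [1]. The vertices of each [S j T] are at the
    apex or strictly above the real axis, so [triangle_sector] applies; finitely many [j] share a
    constant. *)
Lemma sector_last : 0 < eta2 ell q z -> exists2 m : R, 0 < m &
  forall j w, (1 <= j < ell)%N -> T w ->
    m * normc ((S j w - 1) / (z q - 1) - 1) <= complex.Im ((S j w - 1) / (z q - 1)).
Proof.
move=> eta; pose P j m := (1 <= j)%N -> forall w, T w ->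
  m * normc ((S j w - 1) / (z q - 1) - 1) <= complex.Im ((S j w - 1) / (z q - 1)).
have q1 : z q - 1 != 0 by rewrite subr_eq0 q_neq1.
suff [m m0 H] : exists2 m, 0 < m & forall j, (j < ell)%N -> P j m.
  by exists m => // j w /andP[j1 jl]; exact: H.
apply: exists_uniform => [j m m' m'0 mm' H j1 w Tw|j jl].
  by apply: le_trans (H j1 w Tw); rewrite ler_wpM2r ?normc_ge0.
have [->|j0] := posnP j; first by exists 1 => //; rewrite /P ltn0.
pose U w := (z q - 1)^-1 * w - (z q - 1)^-1.
have UE w : (w - 1) / (z q - 1) = U w by rewrite /U; ring.
have Uq : U (z q) = 1 by rewrite -UE divff.
have pos w : w = z q \/ 0 < bary0 (z q) w -> U w = 1 \/ 0 < complex.Im (U w).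
  by case=> [->|b0]; [left|right; rewrite -UE Im_ratio0 // mulr_gt0 ?far0_gt0].
have [|m m0 H] := @triangle_sector _ (U (S j 0)) (U (S j 1)) (U (S j (z q))).
  move=> w; rewrite !inE simil_at0 simil_at1 => /or3P[]/eqP->; apply: pos.
  - by apply: vertex_bary0; lia.
  - exact: vertex_bary0.
  - by apply: simil_apex_bary0 => //; lia.
exists m => // _ w Tw; rewrite UE; apply: H.
by rewrite !similE; do 2!apply: triangle_affine.
Qed.

Lemma sector_first : 0 < eta1 ell q z -> exists2 m : R, 0 < m &
  forall j w, (1 < j <= ell)%N -> T w ->
    m * normc (S j w / z q - 1) <= - complex.Im (S j w / z q).
Proof.
move=> eta; pose P j m := (1 < j)%N -> forall w, T w ->
  m * normc (S j w / z q - 1) <= - complex.Im (S j w / z q).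
have zq0 := q_neq0 hzq.
suff [m m0 H] : exists2 m, 0 < m & forall j, (j < ell.+1)%N -> P j m.
  by exists m => // j w /andP[j1 jl]; exact: H.
apply: exists_uniform => [j m m' m'0 mm' H j1 w Tw|j jl].
  by apply: le_trans (H j1 w Tw); rewrite ler_wpM2r ?normc_ge0.
have [j1|j1] := leqP j 1; first by exists 1 => //; rewrite /P ltnNge j1.
(* The point reflection in [1] carries the sector into the upper half-plane. *)
pose V w := - (z q)^-1 * w + 2.
have VE w : w / z q = 2 - V w by rewrite /V; ring.
have Vq : V (z q) = 1 by rewrite /V mulNr mulVf //; ring.
have ImV w : complex.Im (V w) = - complex.Im (w / z q).
  by rewrite VE ImB; case: (V w) => x y /=; ring.
have pos w : w = z q \/ 0 < bary1 (z q) w -> V w = 1 \/ 0 < complex.Im (V w).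
  case=> [->|b0]; [by left|right].
  by rewrite ImV Im_ratio1 // opprK mulr_gt0 ?far1_gt0.
have [|m m0 H] := @triangle_sector _ (V (S j 0)) (V (S j 1)) (V (S j (z q))).
  move=> w; rewrite !inE simil_at0 simil_at1 => /or3P[]/eqP->; apply: pos.
  - by apply: vertex_bary1; lia.
  - by apply: vertex_bary1; lia.
  - by apply: simil_apex_bary1 => //; lia.
exists m => // _ w Tw; rewrite -ImV.
have -> : S j w / z q - 1 = - (V (S j w) - 1) by rewrite VE; ring.
rewrite normcN; apply: H.
by rewrite !similE; do 2!apply: triangle_affine.
Qed.

End BasicFigures.

(** * The attractor, its small copies and the order of its pieces *)

Section SelfSimilarArc.
Variables (R : realType) (ell q : nat) (z : nat -> R[i]) (Lam : set R[i]).
Hypotheses (hbf : basic_figure ell q z) (hz0 : z 0%N = 0) (hz1 : z ell = 1).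
Hypotheses (hzq : 0 < complex.Im (z q)) (hatt : attractor ell z Lam).
Implicit Types (v w : R[i]) (i j n : nat).

Local Notation T := (triangle 0 1 (z q)).
Local Notation S := (simil ell z).
Local Notation a := (simil_coef ell z).
Local Notation r := (simil_ratio ell z).

Let ell_gt0 : (0 < ell)%N.
Proof. by have /andP[_] := apex_range hbf hz0 hz1 hzq; exact: leq_trans. Qed.

Lemma exists_expr_lt (x e : R) : 0 <= x < 1 -> 0 < e -> exists n, x ^+ n < e.
Proof.
case/andP=> x0 x1 e0; have nx : `|x| < 1 by rewrite ger0_norm.
have /cvgrPdist_lt /(_ _ e0) [n _ /(_ n (leqnn n))] := cvg_expr nx.
by rewrite /= sub0r normrN ger0_norm ?exprn_ge0 //; exists n.
Qed.

Lemma attractor_simil j w : (1 <= j <= ell)%N -> Lam w -> Lam (S j w).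
Proof. by case: hatt => _ _ E jl Lw; rewrite E; exists j => //; exists w. Qed.

Lemma attractor_cover w : Lam w ->
  exists j, (1 <= j <= ell)%N /\ exists2 v, Lam v & S j v = w.
Proof. by case: hatt => _ _ E; rewrite {1}E => -[j jl jw]; exists j. Qed.

Lemma attractor_first n w : Lam w -> Lam ((r 1%N)%:C ^+ n * w).
Proof.
have [aE _] := coef_first hbf hz0 hz1 ell_gt0.
elim: n w => [|n IH] w Lw; first by rewrite mul1r.
have /IH : Lam (S 1%N w) by apply: attractor_simil; rewrite ?lexx.
by rewrite similE // hz0 addr0 aE mulrA -exprSr.
Qed.

Lemma attractor_last n w : Lam w -> Lam ((r ell)%:C ^+ n * (w - 1) + 1).
Proof.
have [aE _] := coef_last hbf hz0 hz1 ell_gt0.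
elim: n w => [|n IH] w Lw; first by rewrite mul1r subrK.
have /IH : Lam (S ell w) by apply: attractor_simil => //; rewrite ell_gt0 /=.
by rewrite similE1 // hz1 addrK aE mulrA -exprSr.
Qed.

Let Lam_closed : closed Lam.
Proof. by case: hatt => _ /compact_closed_plane. Qed.

(** [0] is the limit of the iterates of any point of the attractor under [S 1], and the attractor is
    closed. *)
Lemma attractor0 : Lam 0.
Proof.
have [[w Lw] cL _] := hatt; apply: closed_normcP => // e e0.
have [_ /andP[/ltW r0 r1]] := coef_first hbf hz0 hz1 ell_gt0.
have n0 : 0 < normc w + 1 by rewrite ltr_wpDl ?normc_ge0.
have [||n en] := @exists_expr_lt (r 1%N) (e / (normc w + 1)).
- by rewrite r0.
- exact: divr_gt0.
exists ((r 1%N)%:C ^+ n * w); first exact: attractor_first.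
rewrite sub0r normcN Normc.normcM normcX normc_real ger0_norm //.
move: en; rewrite ltr_pdivlMr //; apply: le_lt_trans.
by rewrite ler_wpM2l ?exprn_ge0 // lerDl.
Qed.

Lemma attractor1 : Lam 1.
Proof.
have [[w Lw] cL _] := hatt; apply: closed_normcP => // e e0.
have [_ /andP[/ltW r0 r1]] := coef_last hbf hz0 hz1 ell_gt0.
have n0 : 0 < normc (w - 1) + 1 by rewrite ltr_wpDl ?normc_ge0.
have [||n en] := @exists_expr_lt (r ell) (e / (normc (w - 1) + 1)).
- by rewrite r0.
- exact: divr_gt0.
exists ((r ell)%:C ^+ n * (w - 1) + 1); first exact: attractor_last.
rewrite opprD addrCA subrr addr0 normcN Normc.normcM normcX normc_real ger0_norm //.
move: en; rewrite ltr_pdivlMr //; apply: le_lt_trans.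
by rewrite ler_wpM2l ?exprn_ge0 // lerDl.
Qed.

Lemma attractor_vertex j : (j <= ell)%N -> Lam (z j).
Proof.
case: j => [|j] jl; first by rewrite hz0; exact: attractor0.
by rewrite -(simil_at1 hz0 hz1); apply: attractor_simil => //; exact: attractor1.
Qed.

Lemma ratio_bound : exists2 rho : R, 0 <= rho < 1 &
  forall j, (1 <= j <= ell)%N -> r j <= rho.
Proof.
have [||m m0 H] := @exists_uniform R ell.+1 (fun j m => (1 <= j)%N -> m <= 1 - r j).
- by move=> j m m' _ mm' + j1 => /(_ j1); exact: le_trans.
- move=> j jl; have [->|j0] := posnP j; first by exists 1.
  exists (1 - r j) => //; rewrite subr_gt0 (bf_contractive hbf) //.
  by rewrite j0.
have [_ /andP[r0 _]] := coef_first hbf hz0 hz1 ell_gt0.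
have := H 1%N ell_gt0 isT => m1.
exists (1 - m) => [|j /andP[j1 jl]]; first by apply/andP; split; lra.
by have := H j jl j1; lra.
Qed.

(** The map [k * v + d] is a composition of [n] of the similitudes, with [n] such that the [n]-th
    power of the largest ratio bound is below [e]. *)
Lemma attractor_cylinder (e : R) w : 0 < e -> Lam w ->
  exists k d, [/\ k != 0, normc k < e, forall v, Lam v -> Lam (k * v + d),
    forall v, T v -> T (k * v + d) & exists2 v, Lam v & k * v + d = w].
Proof.
have [rho rho01 rhoP] := ratio_bound.
move=> e0; have [n en] := exists_expr_lt rho01 e0.
have /andP[rho0 _] := rho01.
suff H m v : Lam v -> exists k d, [/\ k != 0, normc k <= rho ^+ m,
    forall v, Lam v -> Lam (k * v + d), forall v, T v -> T (k * v + d)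
    & exists2 u, Lam u & k * u + d = v].
  move=> /(H n)[k [d [k0 kn Lk Tk kw]]]; exists k, d; split=> //.
  exact: le_lt_trans en.
elim: m v => [|m IH] v Lv.
  exists 1, 0; split; rewrite ?oner_eq0 ?Normc.normc1 //.
  - by move=> u; rewrite mul1r addr0.
  - by move=> u; rewrite mul1r addr0.
  - by exists v; rewrite // mul1r addr0.
have [j [jl [u Lu <-]]] := attractor_cover Lv.
have [k [d [k0 kn Lk Tk [x Lx <-]]]] := IH u Lu.
exists (a j * k), (a j * d + z j.-1).
have SE y : a j * k * y + (a j * d + z j.-1) = S j (k * y + d).
  by rewrite similE //; ring.
split.
- by rewrite mulf_neq0 // (coef_neq0 hbf).
- by rewrite Normc.normcM exprS ler_pM ?normc_ge0 // rhoP.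
- by move=> y Ly; rewrite SE; apply: attractor_simil => //; exact: Lk.
- by move=> y Ty; rewrite SE; apply: (simil_triangle hbf) => //; exact: Tk.
- by exists x => //; rewrite SE.
Qed.

Let Lam_bounded : exists2 M : R, 0 < M & forall w, Lam w -> normc w <= M.
Proof. by case: hatt => _ /compact_bounded_plane. Qed.

(** A small copy through [w] also contains, or has in its closed triangle, the image of [0], a point
    of [T] close to [w]; and [T] is closed. *)
Lemma attractor_triangle : Lam `<=` T.
Proof.
move=> w Lw; apply: closed_normcP => [|e e0]; first exact: triangle_closed.
have [M M0 LM] := Lam_bounded.
have [|k [d [k0 ke Lk Tk [v Lv <-]]]] := @attractor_cylinder (e / M) w _ Lw.
  by rewrite divr_gt0.
exists (k * 0 + d); first by apply: Tk; exact: triangle_vertex1.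
rewrite mulr0 add0r addrK Normc.normcM.
move: ke; rewrite ltr_pdivlMr //; apply: le_lt_trans.
by rewrite ler_wpM2l ?normc_ge0 // LM.
Qed.

Section Chart.
Variables (f : R -> R[i]) (g : R[i] -> R).
Hypothesis ch : arc_chart f g Lam.

Let phi j s := g (a j * f s + z j.-1).

Let LamS j w : (1 <= j <= ell)%N -> Lam w -> Lam (a j * w + z j.-1).
Proof. by move=> jl Lw; rewrite -similE //; exact: attractor_simil. Qed.

Let phi_embedding j : (1 <= j <= ell)%N -> unit_embedding (phi j).
Proof.
move=> jl; apply: chart_affine_embedding ch _ _; first exact: (coef_neq0 hbf).
by move=> w; exact: LamS.
Qed.

(* Two pieces sharing a subarc would share a whole small copy of the
   attractor, hence a copy of the triangle spanned by [0], [1] and the apex,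
   although the images of the open triangle are pairwise disjoint. *)
Lemma piece_overlap i j : (1 <= i <= ell)%N -> (1 <= j <= ell)%N -> i != j ->
  overlap_le1 (phi i) (phi j).
Proof.
move=> il jl ij s1 s2 t1 t2 s1I s2I t1I t2I e1 e2; apply: contrapT => ne.
wlog lt12 : s1 s2 t1 t2 s1I s2I t1I t2I e1 e2 ne / phi i s1 < phi i s2.
  move=> H; have [l|l|//] := ltgtP (phi i s1) (phi i s2).
    exact: H s1I s2I t1I t2I e1 e2 ne l.
  by apply: H s2I s1I t2I t1I e2 e1 _ l => /esym.
have [fA gI fK gK _ cg] := ch.
pose piece n := [set a n * v + z n.-1 | v in Lam].
have fphi n s : (1 <= n <= ell)%N -> s \in `[0, 1] -> piece n (f (phi n s)).
  move=> nl sI; rewrite /phi gK; first by exists (f s) => //; exact: fA.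
  by apply: LamS => //; exact: fA.
have gphi n s : (1 <= n <= ell)%N -> s \in `[0, 1] -> g (f (phi n s)) = phi n s.
  by move=> nl sI; rewrite fK // gI //; apply: LamS => //; exact: fA.
have between n w : (1 <= n <= ell)%N -> piece n (f (phi i s1)) ->
    piece n (f (phi i s2)) -> Lam w -> phi i s1 <= g w -> g w <= phi i s2 ->
    piece n w.
  move=> nl p1 p2 Lw l1 l2; apply: (chart_affine_between ch _ p1 p2 Lw).
  - by move=> v; exact: LamS.
  - by rewrite gphi.
  - by rewrite gphi.
(* Midpoint and half-length of the shared parameter interval: by continuity of [g], a small enough
   cylinder through [f m] has all its parameters there. *)
pose m := (phi i s1 + phi i s2) / 2.
pose dl := (phi i s2 - phi i s1) / 2.
have dl0 : 0 < dl by rewrite divr_gt0 ?subr_gt0.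
have mI : m \in `[0, 1].
  have := gI _ (LamS il (fA _ s1I)); have := gI _ (LamS il (fA _ s2I)).
  by rewrite -/(phi i s1) -/(phi i s2) !in_itv /= /m; lra.
have Lm := fA _ mI.
have [e e0 eP] : exists2 e : R, 0 < e &
    forall w, Lam w -> normc (f m - w) < e -> `|m - g w| < dl.
  move/subspace_continuousP: cg => /(_ _ Lm) /cvgrPdist_lt /(_ _ dl0).
  move=> /nbhs_normcP[e e0 eP]; exists e => // w Lw we.
  have : `|g (f m) - g w| < dl by exact: eP.
  by rewrite fK.
have [M M0 LM] := Lam_bounded.
have eM : 0 < e / (M + M) by rewrite divr_gt0 // addr_gt0.
have [k [d [k0 ke Lk Tk [v Lv kv]]]] := attractor_cylinder eM Lm.
have near w : Lam w -> phi i s1 <= g (k * w + d) <= phi i s2.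
  move=> Lw; have /(eP _ (Lk _ Lw)) : normc (f m - (k * w + d)) < e.
    rewrite -kv opprD addrACA subrr addr0 -mulrBr Normc.normcM.
    move: ke; rewrite ltr_pdivlMr ?addr_gt0 //; apply: le_lt_trans.
    by rewrite ler_wpM2l ?normc_ge0 // (le_trans (le_normcD _ _)) // normcN lerD ?LM.
  by rewrite ltr_norml /m /dl; lra.
(* Since [0], [1] and the apex belong to the attractor, the copy of the triangle has its vertices in
   [S n T], and convexity does the rest. *)
have copy n : (1 <= n <= ell)%N -> piece n (f (phi i s1)) ->
    piece n (f (phi i s2)) ->
    forall v, T v -> exists2 u, T u & k * v + d = S n u.
  move=> nl p1 p2 w Tw.
  have inv y : Lam y -> exists2 u, T u & u = (a n)^-1 * (k * y + d) - (a n)^-1 * z n.-1.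
    move=> Ly; have /andP[l1 l2] := near _ Ly.
    have [x Lx e'] := between n _ nl p1 p2 (Lk _ Ly) l1 l2.
    exists x; first exact: attractor_triangle.
    by rewrite -e'; field; exact: (coef_neq0 hbf).
  have [u0 Tu0 E0] := inv _ attractor0; have [u1 Tu1 E1] := inv _ attractor1.
  have [u2 Tu2 E2] := inv _ (attractor_vertex (bf_apex hbf)).
  exists ((a n)^-1 * (k * w + d) - (a n)^-1 * z n.-1); last first.
    by rewrite similE //; field; exact: (coef_neq0 hbf).
  apply: triangle_convex Tu0 Tu1 Tu2 _ _; rewrite E0 E1 E2.
  by do 2!apply: triangle_affine.
apply: (no_common_copy hbf hz0 hz1 hzq il jl ij k0 (d := d)); apply: copy => //.
- exact: fphi.
- exact: fphi.
- by rewrite e1; exact: fphi.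
- by rewrite e2; exact: fphi.
Qed.

Lemma phi_at j w : Lam w -> phi j (g w) = g (S j w).
Proof. by case: ch => _ _ _ gK _ _ Lw; rewrite /phi gK // similE. Qed.

(* [z 1] is common to the first two pieces, hence an end of both of them; as it
   is [S 1 1 = S 2 0], both [1] and [0] are ends of the arc. *)
Lemma chart_ends : (1 < ell)%N ->
  (f 0 = 0 /\ f 1 = 1) \/ (f 0 = 1 /\ f 1 = 0).
Proof.
move=> l1; have r1 : (1 <= 1 <= ell)%N by lia.
have r2 : (1 <= 2 <= ell)%N by lia.
have [_ gI _ gK _ _] := ch.
have e : phi 1%N (g 1) = phi 2%N (g 0).
  rewrite !phi_at ?simil_at0 ?simil_at1 //; [exact: attractor0|exact: attractor1].
have I0 := gI _ attractor0; have I1 := gI _ attractor1.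
have K0 := gK _ attractor0; have K1 := gK _ attractor1.
have E1 := overlap_le1_endpoint (phi_embedding r1) (phi_embedding r2)
  (piece_overlap r1 r2 isT) I1 I0 e.
have E0 := overlap_le1_endpoint (phi_embedding r2) (phi_embedding r1)
  (piece_overlap r2 r1 isT) I0 I1 (esym e).
have n01 : (0 : R[i]) <> 1 by move=> /esym/eqP; rewrite oner_eq0.
case: E0 K0 => -> K0; case: E1 K1 => -> K1; [|by left|by right|].
- by case: n01; rewrite -K0.
- by case: n01; rewrite -K0.
Qed.

Hypotheses (f0 : f 0 = 0) (f1 : f 1 = 1).

(** The first piece starts at the least parameter, 0, so it goes up; each later piece starts where
    the previous one ends and cannot turn back over it. *)
Lemma vertices_increasing j : (1 <= j <= ell)%N -> g (z j.-1) < g (z j).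
Proof.
have [_ _ g0 g1] := chart_endpoints ch; rewrite f0 in g0; rewrite f1 in g1.
have E0 n : phi n 0 = g (z n.-1).
  by rewrite -g0 phi_at ?simil_at0 //; exact: attractor0.
have E1 n : phi n 1 = g (z n).
  by rewrite -g1 phi_at ?simil_at1 //; exact: attractor1.
elim: j => // j IH jl; have [j0|j0] := posnP j.
  have zI : g (z 1%N) \in `[0, 1] by apply: (chart_itv ch); apply: attractor_vertex.
  have := unit_embedding_neq (phi_embedding jl); rewrite E0 E1 j0 /= hz0 g0 => ne.
  by rewrite lt_neqAle ne; move: zI; rewrite in_itv /= => /andP[].
have jl' : (1 <= j <= ell)%N by lia.
have jj : j != j.+1 by rewrite neq_ltn ltnSn.
have := overlap_le1_increasing (phi_embedding jl') (phi_embedding jl)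
  (piece_overlap jl' jl jj).
by rewrite !E0 !E1; apply=> //; exact: IH.
Qed.

(** Translates the order constraints of [condition_Q] into membership in a piece. *)
Lemma pieceP j x : (1 <= j <= ell)%N -> Lam x ->
  (exists2 w, Lam w & S j w = x) <-> g (z j.-1) <= g x <= g (z j).
Proof.
move=> jl Lx.
have inc := vertices_increasing jl.
have [_ _ g0 g1] := chart_endpoints ch; rewrite f0 in g0; rewrite f1 in g1.
split=> [[w Lw <-]|/andP[l1 l2]].
  have := unit_embedding_bounds (phi_embedding jl) (chart_itv ch Lw).
  rewrite -g0 -g1 !phi_at ?simil_at0 ?simil_at1 //;
    try exact: attractor0; try exact: attractor1.
  by rewrite /Order.min /Order.max inc.
have [|||w Lw e] := chart_affine_between ch (a := a j) (b := z j.-1) _ _ _ Lx l1 l2.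
- by move=> w; exact: LamS.
- by exists 0; [exact: attractor0|rewrite mulr0 add0r].
- by exists 1; [exact: attractor1|rewrite -similE // simil_at1].
by exists w => //; rewrite similE.
Qed.

End Chart.

Lemma oriented_chart : (1 < ell)%N -> is_arc Lam ->
  exists f g, [/\ arc_chart f g Lam, f 0 = 0 & f 1 = 1].
Proof.
move=> l1 [f /arc_homeomorphism_chart[g ch]].
have [[f0 f1]|[f0 f1]] := chart_ends ch l1; first by exists f, g.
exists (f \o (fun s => 1 - s)), (fun w => 1 - g w); split=> /=.
- exact: chart_reverse.
- by rewrite subr0.
- by rewrite subrr.
Qed.

End SelfSimilarArc.

(** * Inequalities for sectors and for scales *)

Section CornerEstimates.
Variable R : realType.

(** Write [A - B] as [A u - B v] minus [A (u - 1)] plus [B (v - 1)]. The last two terms are bounded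
    through [A Im u] and [- B Im v]; both being nonnegative, their sum is the imaginary part of
    [A u - B v]. *)
Lemma sector_gap (m A B : R) (u v : R[i]) : 0 < m -> 0 <= A -> 0 <= B ->
  m * normc (u - 1) <= complex.Im u -> m * normc (v - 1) <= - complex.Im v ->
  m * `|A - B| <= (1 + m) * normc (A%:C * u - B%:C * v).
Proof.
move=> m0 A0 B0 hu hv; pose d := A%:C * u - B%:C * v.
have hA := ler_wpM2l A0 hu; have hB := ler_wpM2l B0 hv.
have Imd : A * complex.Im u + B * - complex.Im v <= normc d.
  apply: le_trans (ler_Im_normc d); apply: le_trans (ler_norm _).
  by rewrite /d ImB !Im_realM mulrN.
have : `|A - B| <= normc d + A * normc (u - 1) + B * normc (v - 1).
  have -> : `|A - B| = normc (d - A%:C * (u - 1) + B%:C * (v - 1)).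
    by rewrite -normc_real rmorphB /d; congr normc; ring.
  rewrite (le_trans (le_normcD _ _)) // lerD //; last first.
    by rewrite Normc.normcM normc_real ger0_norm.
  rewrite (le_trans (le_normcD _ _)) // lerD // normcN.
  by rewrite Normc.normcM normc_real ger0_norm.
by move=> /(ler_wpM2l (ltW m0)); rewrite -/d; lra.
Qed.

(** Admits the scale 0. Against it, a scale [s <= 1] satisfies [s ^ t <= s] because [1 <= t], and
    [s] is [alpha^-1] or [beta^-1] times the gap. *)
Lemma powR_gap_scales (t alpha beta C : R) (P Q : R -> Prop) :
  1 <= t -> 0 < alpha -> 0 < beta -> 0 < C ->
  (forall s, P s -> 0 < s <= 1) -> (forall s, Q s -> 0 < s <= 1) ->
  (forall s s', P s -> Q s' -> (s + s') `^ t <= C * `|alpha * s - beta * s'|) ->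
  exists2 C' : R, 0 < C' & forall s s', s = 0 \/ P s -> s' = 0 \/ Q s' ->
    (s + s') `^ t <= C' * `|alpha * s - beta * s'|.
Proof.
move=> t1 al0 be0 C0 P01 Q01 H.
have ia : 0 < alpha^-1 by rewrite invr_gt0.
have ib : 0 < beta^-1 by rewrite invr_gt0.
have C'0 : 0 < C + alpha^-1 + beta^-1 by rewrite !addr_gt0.
exists (C + alpha^-1 + beta^-1) => // s s' [->|Ps] [->|Qs].
- by rewrite addr0 powR0 ?mulr_ge0 ?(ltW C'0) //; lra.
- have /andP[s0 s1] := Q01 _ Qs; rewrite add0r mulr0 sub0r normrN.
  rewrite gtr0_norm ?mulr_gt0 //; apply: le_trans (ge1r_powR _ t1) _; first by rewrite s0.
  rewrite -{1}[s'](mulKf (lt0r_neq0 be0)).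
  by apply: ler_wpM2r; [rewrite mulr_ge0 ?ltW|lra].
- have /andP[s0 s1] := P01 _ Ps; rewrite addr0 mulr0 subr0.
  rewrite gtr0_norm ?mulr_gt0 //; apply: le_trans (ge1r_powR _ t1) _; first by rewrite s0.
  rewrite -{1}[s](mulKf (lt0r_neq0 al0)).
  by apply: ler_wpM2r; [rewrite mulr_ge0 ?ltW|lra].
- apply: le_trans (H _ _ Ps Qs) _.
  by apply: ler_wpM2r => //; lra.
Qed.

End CornerEstimates.

(** * The arc near a corner of angle zero *)

Section Corner.
Variables (R : realType) (ell q : nat) (z : nat -> R[i]) (Lam : set R[i]).
Variable p : nat.
Hypotheses (hbf : basic_figure ell q z) (hz0 : z 0%N = 0) (hz1 : z ell = 1).
Hypotheses (hzq : 0 < complex.Im (z q)) (hatt : attractor ell z Lam).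
Hypothesis hp : (1 <= p <= ell.-1)%N.
Implicit Types (w X Y : R[i]).

Local Notation T := (triangle 0 1 (z q)).
Local Notation S := (simil ell z).
Local Notation a := (simil_coef ell z).
Local Notation r := (simil_ratio ell z).

Let p_range : (1 <= p <= ell)%N. Proof. by clear -hp; lia. Qed.
Let pS_range : (1 <= p.+1 <= ell)%N. Proof. by clear -hp; lia. Qed.
Let ell_gt0 : (0 < ell)%N. Proof. by clear -hp; lia. Qed.
Let ell_range : (1 <= ell <= ell)%N. Proof. by rewrite ell_gt0 leqnn. Qed.

Definition corner_alpha : R := r p * normc (1 - z q).
Definition corner_beta : R := r p.+1 * normc (z q).
Local Notation alpha := corner_alpha.
Local Notation beta := corner_beta.

Lemma corner_alpha_gt0 : 0 < alpha.
Proof.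
by rewrite mulr_gt0 ?(ratio_gt0 hbf) // normc_gt0 subr_eq0 eq_sym q_neq1.
Qed.

Lemma corner_beta_gt0 : 0 < beta.
Proof. by rewrite mulr_gt0 ?(ratio_gt0 hbf) // normc_gt0 q_neq0. Qed.

(** [theta_min] is at most [theta p = 0], so [xi > 0] forces [eta0 > 0]. *)
Lemma etas_gt0 : 0 < xi ell q z -> theta ell q z p = 0 ->
  0 < eta1 ell q z /\ 0 < eta2 ell q z.
Proof.
rewrite /xi /theta_min /eta0 => xi0 th.
have pI : p \in index_iota 1 ell by rewrite mem_index_iota; clear -hp; lia.
have := @ge_bigmin_seq _ _ _ (index_iota 1 ell) (theta ell q z 1%N) p xpredT
  (theta ell q z) pI isT.
rewrite th => le0.
have : 0 < Num.min (eta1 ell q z) (eta2 ell q z) by lra.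
by rewrite lt_min => /andP[].
Qed.

(* As [theta p = 0], the triangles [S p T] and [S p.+1 T] have sides on a common
   ray from [z p]; both coordinates are taken along that ray. *)
Lemma corner_dist X Y : theta ell q z p = 0 ->
  normc (S p X - S p.+1 Y) =
  normc (alpha%:C * ((X - 1) / (z q - 1)) - beta%:C * (Y / z q)).
Proof.
move=> th; have q1 : z q - 1 != 0 by rewrite subr_eq0 q_neq1.
have zq0 := q_neq0 hzq; have ap := coef_neq0 hbf hz0 hz1 p_range.
have aS := coef_neq0 hbf hz0 hz1 pS_range.
have b0 : beta%:C != 0 :> R[i] by rewrite fmorph_eq0 gt_eqF ?corner_beta_gt0.
have nE : normc (z q - 1) = normc (1 - z q) by rewrite normcBC.
(* Vanishing of [theta p] makes the quotient of the two apex displacements equal to its modulus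
   [alpha / beta]. *)
have aE : a p * (z q - 1) = alpha%:C * (a p.+1 * z q / beta%:C).
  have /argc_eq0 : argc ((a p * (z q - 1)) / (a p.+1 * z q)) = 0.
    rewrite -th /theta (similE1 hz0 hz1 p) (similE ell hz0 p.+1) /=.
    by rewrite !addrK.
  have nP : normc (a p * (z q - 1)) = alpha by rewrite Normc.normcM nE.
  have nS : normc (a p.+1 * z q) = beta by rewrite Normc.normcM.
  rewrite Normc.normcM Normc.normcV nP nS rmorphM fmorphV => e.
  by rewrite -[LHS](divfK (mulf_neq0 aS zq0)) e; ring.
have EE : normc (a p.+1 * z q / beta%:C) = 1.
  rewrite Normc.normcM Normc.normcV normc_real gtr0_norm ?corner_beta_gt0 //.
  by rewrite Normc.normcM divff // gt_eqF ?corner_beta_gt0.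
rewrite (similE1 hz0 hz1) (similE ell hz0) /=.
(* The unit vector along the common ray. *)
set E := _ / beta%:C in aE EE.
have -> : a p * (X - 1) + z p - (a p.+1 * Y + z p) =
    E * (alpha%:C * ((X - 1) / (z q - 1)) - beta%:C * (Y / z q)).
  have -> : a p * (X - 1) = a p * (z q - 1) * ((X - 1) / (z q - 1)) by field.
  by rewrite aE /E; field; rewrite ?b0 ?zq0 ?q1.
by rewrite Normc.normcM EE mul1r.
Qed.

Let Lam_bounded : exists2 M : R, 0 < M & forall w, Lam w -> normc w <= M.
Proof. by case: hatt => _ /compact_bounded_plane. Qed.

(** Otherwise [X] would lie in every iterated image of the attractor under [S ell], and these shrink
    to [1]. *)
Lemma attractor_peel_last X : Lam X -> X <> 1 -> exists n i W,
  [/\ (1 <= i < ell)%N, Lam W & X = (r ell)%:C ^+ n * (S i W - 1) + 1].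
Proof.
move=> LX X1; have [M M0 LM] := Lam_bounded.
have [aE /andP[r0 r1]] := coef_last hbf hz0 hz1 ell_gt0.
have d0 : 0 < normc (X - 1) by rewrite normc_gt0 subr_eq0; apply/eqP.
have M10 : 0 < M + 1 by rewrite addr_gt0.
have [||n en] := @exists_expr_lt R (r ell) (normc (X - 1) / (M + 1)).
- by rewrite ltW.
- exact: divr_gt0.
apply: contrapT => none.
have H k : exists2 W, Lam W & X = (r ell)%:C ^+ k * (W - 1) + 1.
  elim: k => [|k [W LW E]]; first by exists X; rewrite // mul1r subrK.
  have [i [/andP[i1 il] [V LV VW]]] := attractor_cover hatt LW.
  move: il; rewrite leq_eqVlt => /predU1P[il|il].
    by exists V => //; rewrite E -VW il (similE1 hz0 hz1) hz1 addrK aE exprSr mulrA.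
  by case: none; exists k, i, V; split; rewrite ?i1 // VW.
have [W LW E] := H n; move: en; rewrite ltr_pdivlMr // ltNge => /negP; apply.
rewrite E addrK Normc.normcM normcX normc_real gtr0_norm //.
apply: ler_wpM2l; first by rewrite exprn_ge0 ?ltW.
by rewrite (le_trans (le_normcD _ _)) // normcN Normc.normc1 lerD2r LM.
Qed.

Lemma attractor_peel_first Y : Lam Y -> Y <> 0 -> exists n i W,
  [/\ (1 < i <= ell)%N, Lam W & Y = (r 1%N)%:C ^+ n * S i W].
Proof.
move=> LY Y0; have [M M0 LM] := Lam_bounded.
have [aE /andP[r0 r1]] := coef_first hbf hz0 hz1 ell_gt0.
have d0 : 0 < normc Y by rewrite normc_gt0; apply/eqP.
have [||n en] := @exists_expr_lt R (r 1%N) (normc Y / M).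
- by rewrite ltW.
- exact: divr_gt0.
apply: contrapT => none.
have H k : exists2 W, Lam W & Y = (r 1%N)%:C ^+ k * W.
  elim: k => [|k [W LW E]]; first by exists Y; rewrite // mul1r.
  have [i [/andP[i1 il] [V LV VW]]] := attractor_cover hatt LW.
  move: i1; rewrite leq_eqVlt => /predU1P[i1|i1].
    by exists V => //; rewrite E -VW -i1 (similE ell hz0) /= hz0 addr0 aE exprSr mulrA.
  by case: none; exists k, i, V; split; rewrite ?i1 // VW.
have [W LW E] := H n; move: en; rewrite ltr_pdivlMr // ltNge => /negP; apply.
rewrite E Normc.normcM normcX normc_real gtr0_norm //.
by apply: ler_wpM2l (LM _ _) => //; rewrite exprn_ge0 ?ltW.
Qed.

Variables (f : R -> R[i]) (g : R[i] -> R).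
Hypotheses (ch : arc_chart f g Lam) (f0 : f 0 = 0) (f1 : f 1 = 1).

Let Lam_zp : Lam (z p).
Proof. by apply: (attractor_vertex hbf) => //; case/andP: p_range. Qed.

(* The value [s = 0] encodes [X = 1], that is [S p X = z p]. *)
Lemma corner_scale_last : 0 < eta2 ell q z -> exists m M : R,
  [/\ 0 < m, 0 < M & forall X, Lam X -> exists s u,
    [/\ s = 0 \/ (exists j, s = r ell ^+ j),
        (X - 1) / (z q - 1) = s%:C * u, m * normc (u - 1) <= complex.Im u
      & forall w, Lam w -> g (S p X) <= g w -> g w <= g (z p) ->
          normc (w - z p) <= s * M]].
Proof.
move=> /(sector_last hbf hz0 hz1 hzq)[m m0 Hm].
have [M M0 LM] := Lam_bounded; exists m, (M + 1); split; rewrite ?addr_gt0 //.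
have LT := attractor_triangle hbf hz0 hz1 hzq hatt.
have gK := chartVK ch.
move=> X LX; have [->|/eqP X1] := eqVneq X 1.
  exists 0, 1; split.
  - by left.
  - by rewrite subrr !mul0r.
  - by rewrite subrr Normc.normc0 mulr0.
  - move=> w Lw; rewrite (simil_at1 hz0 hz1) => l1 l2.
    have e : g w = g (z p) by apply/le_anti; rewrite l1 l2.
    by rewrite -(gK _ Lw) -(gK _ Lam_zp) e subrr Normc.normc0 mul0r.
have [n [i [W [il LW E]]]] := attractor_peel_last LX X1.
have [_ /andP[r0 r1]] := coef_last hbf hz0 hz1 ell_gt0.
exists (r ell ^+ n), ((S i W - 1) / (z q - 1)); split.
- by right; exists n.
- by rewrite E addrK rmorphXn mulrA.
- by apply: Hm => //; exact: LT.
(* The map [k * v + d] is [S p] after [n] applications of [S ell]. Its copy of the arc contains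
   [S p X] and [z p], hence the whole subarc between them. *)
move=> w Lw l1 l2; pose k := a p * (r ell)%:C ^+ n; pose d := z p - k.
have kE v : k * v + d = S p ((r ell)%:C ^+ n * (v - 1) + 1).
  by rewrite (similE1 hz0 hz1) /d /k; ring.
have il' : (1 <= i <= ell)%N by case/andP: il => -> /ltnW.
have [|||v Lv <-] := chart_affine_between ch (a := k) (b := d) _ _ _ Lw l1 l2.
- move=> v Lv; rewrite kE; apply: (attractor_simil hatt) => //.
  exact: (attractor_last hbf).
- exists (S i W); first exact: (attractor_simil hatt).
  by rewrite kE -E.
- by exists 1; [exact: (attractor1 hbf hz0 hz1 hzq hatt)|rewrite /d mulr1 addrC subrK].
have -> : k * v + d - z p = k * (v - 1) by rewrite /d; ring.
rewrite /k 2!Normc.normcM normcX normc_real gtr0_norm // -mulrA.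
apply: le_trans (ler_piMl _ (ltW (bf_contractive hbf p_range))) _.
  by rewrite mulr_ge0 ?exprn_ge0 ?normc_ge0 ?ltW.
apply: ler_wpM2l; first by rewrite exprn_ge0 ?ltW.
by rewrite (le_trans (le_normcD _ _)) // normcN Normc.normc1 lerD2r LM.
Qed.

(** Counterpart beyond [z p]: [s = 0] encodes [Y = 0], and the sector opens downwards. *)
Lemma corner_scale_first : 0 < eta1 ell q z -> exists m M : R,
  [/\ 0 < m, 0 < M & forall Y, Lam Y -> exists s v,
    [/\ s = 0 \/ (exists j, s = r 1%N ^+ j),
        Y / z q = s%:C * v, m * normc (v - 1) <= - complex.Im v
      & forall w, Lam w -> g (z p) <= g w -> g w <= g (S p.+1 Y) ->
          normc (w - z p) <= s * M]].
Proof.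
move=> /(sector_first hbf hz0 hz1 hzq)[m m0 Hm].
have [M M0 LM] := Lam_bounded; exists m, M; split=> //.
have LT := attractor_triangle hbf hz0 hz1 hzq hatt.
have gK := chartVK ch.
move=> Y LY; have [->|/eqP Y0] := eqVneq Y 0.
  exists 0, 1; split.
  - by left.
  - by rewrite !mul0r.
  - by rewrite subrr Normc.normc0 mulr0 /= oppr0.
  - move=> w Lw; rewrite (simil_at0 ell hz0) /= => l1 l2.
    have e : g w = g (z p) by apply/le_anti; rewrite l1 l2.
    by rewrite -(gK _ Lw) -(gK _ Lam_zp) e subrr Normc.normc0 mul0r.
have [n [i [W [il LW E]]]] := attractor_peel_first LY Y0.
have [_ /andP[r0 r1]] := coef_first hbf hz0 hz1 ell_gt0.
exists (r 1%N ^+ n), (S i W / z q); split.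
- by right; exists n.
- by rewrite E rmorphXn mulrA.
- by apply: Hm => //; exact: LT.
move=> w Lw l1 l2; pose k := a p.+1 * (r 1%N)%:C ^+ n.
have kE v : k * v + z p = S p.+1 ((r 1%N)%:C ^+ n * v).
  by rewrite (similE ell hz0) /k /=; ring.
have il' : (1 <= i <= ell)%N by case/andP: il => /ltnW ->.
have [|||v Lv <-] := chart_affine_between ch (a := k) (b := z p) _ _ _ Lw l1 l2.
- move=> v Lv; rewrite kE; apply: (attractor_simil hatt) => //.
  exact: (attractor_first hbf).
- by exists 0; [exact: (attractor0 hbf hz0 hz1 hzq hatt)|rewrite mulr0 add0r].
- exists (S i W); first exact: (attractor_simil hatt).
  by rewrite kE -E.
rewrite addrK /k 2!Normc.normcM normcX normc_real gtr0_norm // -mulrA.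
apply: le_trans (ler_piMl _ (ltW (bf_contractive hbf pS_range))) _.
  by rewrite mulr_ge0 ?exprn_ge0 ?normc_ge0 ?ltW.
by apply: ler_wpM2l (LM _ _) => //; rewrite exprn_ge0 ?ltW.
Qed.

End Corner.

(** * Equivalence of Condition Q and the gap condition on scales *)

Unset Implicit Arguments.
Set Strict Implicit.

Theorem proposition6p6 (R : realType) (ell q : nat) (z : nat -> R[i])
    (Lam : set R[i]) (t : R) (p : nat)
    (hLam : regular_self_similar_arc ell q z Lam)
    (hz0 : z 0%N = 0) (hz1 : z ell = 1) (hzq : 0 < complex.Im (z q))
    (ht : 1 <= t) (hp : (1 <= p <= ell.-1)%N) (htheta : theta ell q z p = 0) :
  let lambda := simil_ratio ell z ell in
  let mu := simil_ratio ell z 1%N in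
  let alpha := simil_ratio ell z p * normc (1 - z q) in
  let beta := simil_ratio ell z p.+1 * normc (z q) in
  condition_Q ell z Lam t p <->
  (exists2 C : R, 0 < C &
    forall j k : nat,
      (lambda ^+ j + mu ^+ k) `^ t
        <= C * `|alpha * lambda ^+ j - beta * mu ^+ k|).
Proof.
move=> lambda mu alpha beta; have [hbf hxi hatt harc] := hLam.
have l1 : (1 < ell)%N by clear -hp; lia.
have pr : (1 <= p <= ell)%N by clear -hp; lia.
have pSr : (1 <= p.+1 <= ell)%N by clear -hp; lia.
have l0 : (0 < ell)%N := ltnW l1.
have [f [g [ch f0 f1]]] := oriented_chart hbf hz0 hz1 hzq hatt l1 harc.
have Lv := attractor_vertex hbf hz0 hz1 hzq hatt.
have LS := attractor_simil hatt.
have [M M0 LM] : exists2 M : R, 0 < M & forall w, Lam w -> normc w <= M.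
  by case: hatt => _ /compact_bounded_plane.
have arcE x y : Lam x -> Lam y ->
    arc_le Lam (z 0%N) (z ell) x y <-> g x <= g y.
  by rewrite hz0 hz1 -f0 -f1; exact: arc_leP.
have Lp1 : Lam (z p.-1) by apply: Lv; clear -hp; lia.
have Lp : Lam (z p) by apply: Lv; case/andP: pr.
have LpS : Lam (z p.+1) by apply: Lv; case/andP: pSr.
have pieceE := pieceP hbf hz0 hz1 hzq hatt ch f0 f1.
have al0 : 0 < alpha by apply: corner_alpha_gt0 hbf hz0 hz1 hzq hp.
have be0 : 0 < beta by apply: corner_beta_gt0 hbf hz0 hz1 hzq hp.
have [_ /andP[lam0 lam1]] := coef_last hbf hz0 hz1 l0.
have [_ /andP[mu0 mu1]] := coef_first hbf hz0 hz1 l0.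
rewrite -/lambda in lam0 lam1; rewrite -/mu in mu0 mu1.
have dist X Y := corner_dist hbf hz0 hz1 hzq hp X Y htheta.
have t0 : 0 <= t := le_trans ler01 ht.
have powR_mono (x y : R) : 0 <= x -> x <= y -> x `^ t <= y `^ t.
  by move=> x0 xy; apply: ge0_ler_powR => //; rewrite nnegrE // (le_trans x0).
have subLam x y w : subarc Lam (z 0%N) (z ell) x y w -> Lam w.
  by case=> -[xw _]; have [] := arc_le_mem xw.
split=> [[C C0 HQ]|[C C0 HC]].
  have zq1 : z q - 1 != 0 by rewrite subr_eq0 q_neq1.
  have zq0 := q_neq0 hzq.
  have Lq : Lam (z q) by apply: Lv; exact: (bf_apex hbf).
  (* The diameter will dominate both [alpha * lambda ^+ j] and [beta * mu ^+ k], hence their mean;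
     whence the half. *)
  have c0 : 0 < Num.min alpha beta / 2 by rewrite divr_gt0 // lt_min al0.
  set c := Num.min alpha beta / 2 in c0.
  exists (C / c `^ t) => [|j k]; first by rewrite divr_gt0 // powR_gt0.
  have lj : 0 <= lambda ^+ j by rewrite exprn_ge0 ?ltW.
  have mk : 0 <= mu ^+ k by rewrite exprn_ge0 ?ltW.
  (* Images of the apex under iterates of [S ell] and [S 1]; [S p] and [S p.+1] carry them onto the
     common ray. *)
  pose X := lambda%:C ^+ j * (z q - 1) + 1; pose Y := mu%:C ^+ k * z q.
  have LX : Lam X by apply: (attractor_last hbf).
  have LY : Lam Y by apply: (attractor_first hbf).
  pose x := simil ell z p X; pose y := simil ell z p.+1 Y.
  have Lx : Lam x by apply: LS.
  have Ly : Lam y by apply: LS.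
  have /andP[x1 x2] : g (z p.-1) <= g x <= g (z p).
    by apply/(pieceE p) => //; exists X.
  have /andP[y1 y2] : g (z p) <= g y <= g (z p.+1).
    by apply/(pieceE p.+1) => //; exists Y.
  have /(_ ((arcE _ _ Lp1 Lx).2 x1) ((arcE _ _ Lx Lp).2 x2)
    ((arcE _ _ Lp Ly).2 y1) ((arcE _ _ Ly LpS).2 y2)) := HQ x y Lx Ly.
  have UE : (X - 1) / (z q - 1) = (lambda ^+ j)%:C.
    by rewrite /X addrK mulfK // rmorphXn.
  have VE : Y / z q = (mu ^+ k)%:C by rewrite /Y mulfK // rmorphXn.
  have -> : normc (x - y) = `|alpha * lambda ^+ j - beta * mu ^+ k|.
    by rewrite dist UE VE -!rmorphM -rmorphB normc_real.
  set d := diam _ => Hd.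
  have sx : subarc Lam (z 0%N) (z ell) x y x.
    by left; split; apply/arcE => //; exact: le_trans x2 y1.
  have sy : subarc Lam (z 0%N) (z ell) x y y.
    by left; split; apply/arcE => //; exact: le_trans x2 y1.
  have sz : subarc Lam (z 0%N) (z ell) x y (z p).
    by left; split; apply/arcE.
  have subM w : subarc Lam (z 0%N) (z ell) x y w -> normc w <= M by move/subLam/LM.
  have dx : alpha * lambda ^+ j <= d.
    apply: le_trans (diam_ge subM sx sz); rewrite -(simil_at0 ell hz0 p.+1).
    rewrite dist UE mul0r mulr0 subr0 -rmorphM normc_real.
    exact: ler_norm.
  have dy : beta * mu ^+ k <= d.
    apply: le_trans (diam_ge subM sz sy); rewrite -(simil_at1 hz0 hz1 p).
    rewrite dist VE subrr mul0r mulr0 sub0r normcN -rmorphM normc_real.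
    exact: ler_norm.
  have cs : c * (lambda ^+ j + mu ^+ k) <= d.
    have ca : c + c <= alpha by rewrite /c -splitr ge_min lexx.
    have cb : c + c <= beta by rewrite /c -splitr ge_min lexx orbT.
    have := ler_wpM2r lj ca; have := ler_wpM2r mk cb; lra.
  have c0' : 0 <= c * (lambda ^+ j + mu ^+ k) by rewrite mulr_ge0 ?addr_ge0 // ltW.
  have := le_trans (powR_mono _ _ c0' cs) Hd.
  rewrite powRM ?addr_ge0 ?(ltW c0) // => H.
  by rewrite [leRHS]mulrAC ler_pdivlMr ?powR_gt0 // [leLHS]mulrC.
have [et1 et2] := etas_gt0 hp hxi htheta.
have [m1 [M1 [m10 M10 H1]]] := corner_scale_last hbf hz0 hz1 hzq hatt hp ch et2.
have [m2 [M2 [m20 M20 H2]]] := corner_scale_first hbf hz0 hz1 hzq hatt hp ch et1.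
pose P1 s := exists j : nat, s = lambda ^+ j.
pose P2 s := exists j : nat, s = mu ^+ j.
have P1I s : P1 s -> 0 < s <= 1.
  by move=> [j ->]; rewrite exprn_gt0 //= exprn_ile1 ?ltW.
have P2I s : P2 s -> 0 < s <= 1.
  by move=> [j ->]; rewrite exprn_gt0 //= exprn_ile1 ?ltW.
have [C' C'0 HC'] : exists2 C' : R, 0 < C' & forall s s', s = 0 \/ P1 s ->
    s' = 0 \/ P2 s' -> (s + s') `^ t <= C' * `|alpha * s - beta * s'|.
  by apply: powR_gap_scales C0 P1I P2I _ => // s s' [j ->] [k ->].
(* [D] is twice [M1 + M2], two points of the subarc being compared through [z p]. *)
pose m := Num.min m1 m2; pose D := M1 + M2 + (M1 + M2).
have m0 : 0 < m by rewrite lt_min m10.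
have D0 : 0 < D by rewrite !addr_gt0.
exists (D `^ t * C' * ((1 + m) / m)).
  by rewrite !mulr_gt0 ?powR_gt0 ?invr_gt0 ?addr_gt0.
move=> x y Lx Ly /(arcE _ _ Lp1 Lx) x1 /(arcE _ _ Lx Lp) x2.
move=> /(arcE _ _ Lp Ly) y1 /(arcE _ _ Ly LpS) y2.
have [X LX EX] : exists2 w, Lam w & simil ell z p w = x.
  by apply/pieceE => //; rewrite x1.
have [Y LY EY] : exists2 w, Lam w & simil ell z p.+1 w = y.
  by apply/pieceE => //; rewrite y1.
have [s [u [Ps Us us sM]]] := H1 X LX; have [s' [v [Qs Vs vs s'M]]] := H2 Y LY.
have s0 : 0 <= s by case: Ps => [->|/P1I/andP[/ltW]].
have s'0 : 0 <= s' by case: Qs => [->|/P2I/andP[/ltW]].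
have near w : subarc Lam (z 0%N) (z ell) x y w ->
    normc (w - z p) <= (s + s') * (M1 + M2).
  move=> xyw; have Lw := subLam _ _ _ xyw.
  have [|] : (g x <= g w /\ g w <= g (z p)) \/ (g (z p) <= g w /\ g w <= g y).
    case: xyw => -[h1 h2].
      have xw := (arcE _ _ Lx Lw).1 h1; have wy := (arcE _ _ Lw Ly).1 h2.
      by have [wz|/ltW wz] := leP (g w) (g (z p)); [left|right].
    (* In this degenerate case [w] lies between [y] and [x] although [x] precedes [y], so all
       parameters equal that of [z p]. *)
    have yw := (arcE _ _ Ly Lw).1 h1; have wx := (arcE _ _ Lw Lx).1 h2.
    by left; split; [exact: le_trans x2 (le_trans y1 yw)|exact: le_trans wx x2].
  - case; rewrite -EX => xw wz; apply: le_trans (sM _ Lw xw wz) _.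
    by rewrite ler_pM ?(ltW M10) ?lerDl ?(ltW M20).
  - case=> zw; rewrite -EY => wy; apply: le_trans (s'M _ Lw zw wy) _.
    by rewrite ler_pM ?(ltW M20) ?lerDr ?(ltW M10).
have dD : diam (subarc Lam (z 0%N) (z ell) x y) <= D * (s + s').
  apply: diam_le => [|w w' xyw xyw'].
    by exists x; left; split; apply/arcE => //; exact: le_trans x2 y1.
  apply: le_trans (le_normcB w (z p) w') _; rewrite [normc (z p - w')]normcBC.
  by have := near _ xyw; have := near _ xyw'; rewrite /D; lra.
have d0 : 0 <= diam (subarc Lam (z 0%N) (z ell) x y).
  have sx : subarc Lam (z 0%N) (z ell) x y x.
    by left; split; apply/arcE => //; exact: le_trans x2 y1.
  have subM w : subarc Lam (z 0%N) (z ell) x y w -> normc w <= M by move/subLam/LM.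
  by apply: le_trans (normc_ge0 _) (diam_ge subM sx sx).
apply: le_trans (powR_mono _ _ d0 dD) _.
rewrite (powRM _ (ltW D0) (addr_ge0 s0 s'0)) -!mulrA ler_wpM2l ?powR_ge0 //.
apply: le_trans (HC' _ _ Ps Qs) _; apply: ler_wpM2l (ltW C'0) _ _ _.
have um : m * normc (u - 1) <= complex.Im u.
  by apply: le_trans us; rewrite ler_wpM2r ?normc_ge0 // ge_min lexx.
have vm : m * normc (v - 1) <= - complex.Im v.
  by apply: le_trans vs; rewrite ler_wpM2r ?normc_ge0 // ge_min lexx orbT.
have A0 : 0 <= alpha * s by rewrite mulr_ge0 // ltW.
have B0 : 0 <= beta * s' by rewrite mulr_ge0 // ltW.
rewrite mulrCA ler_pdivlMl //.
apply: le_trans (sector_gap m0 A0 B0 um vm) _.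
by rewrite -EX -EY dist Us Vs !rmorphM !mulrA.
Qed.
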